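(* Let $n\ge 1$ and let $G_n=G_n(m_1,\dots,m_n)$ be the caterpillar graph with central path $v_1\cdots v_n$ such that $v_i$ has $m_i\ge 1$ legs. Put $t_i=m_i-1$ and let $M_x^n=M_x^n(t_1,\dots,t_n)$. Then \[ M(G_n)\simeq \begin{cases} \bigvee_{\ell=0}^{k}\ \bigvee_{M_{2\ell}^{2k}} S^{k-1+\ell} & \text{if } n=2k,\\[4pt] \bigvee_{\ell=0}^{k}\ \bigvee_{M_{2\ell+1}^{2k+1}} S^{k+\ell} & \text{if } n=2k+1,\end{cases}\] where $\bigvee_c S^j$ denotes a wedge of $c$ copies of $S^j$.
   Context: For a finite simple graph $G$, the matching complex $M(G)$ is the simplicial complex whose vertex set is $E(G)$ and whose faces are the matchings of $G$ (sets of pairwise vertex-disjoint edges). A caterpillar graph is a tree in which every vertex lies on a central path or is adjacent to a vertex of it; a leg at a central vertex is a pendant leaf attached to it. For nonnegative integers $n,x$, $A_x^n$ is the set of strictly increasing sequences $(i_1<\cdots<i_x)$ in $\{1,\dots,n\}$ such that the unmarked positions $\{1,\dots,n\}\setminus\{i_1,\dots,i_x\}$ can be covered by $\frac{n-x}{2}$ disjoint blocks $\{p,p+1\}$ (so $A_x^n=\emptyset$ if $n-x$ is odd, and $A_0^{2k}=\{\text{empty sequence}\}$); $M_x^n(t_1,\dots,t_n)=\sum_{(i_1,\dots,i_x)\in A_x^n}t_{i_1}\cdots t_{i_x}$ (empty product $=1$). *)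

(* Defs.v *)
From HB Require Import structures.
From mathcomp Require Import all_boot all_order all_algebra.
Set Implicit Arguments.
Unset Strict Implicit.
Unset Printing Implicit Defensive.

Record simplicial_complex (V : finType) := SimplicialComplex {
  faces : {set {set V}};
  faces_vertex : forall v : V, [set v] \in faces;
  faces_sub : forall A B : {set V}, A \subset B -> B \in faces -> A \in faces
}.

Record sgraph := SGraph {
  vertex :> finType;
  adj : rel vertex;
  adj_sym : symmetric adj;
  adj_irrefl : irreflexive adj
}.

Definition edges (G : sgraph) : {set {set G}} :=
  [set [set p.1; p.2] | p : G * G & adj p.1 p.2].

Definition edge (G : sgraph) : finType := {e : {set G} | e \in edges G}.

Definition is_matching (G : sgraph) (M : {set edge G}) : bool :=
  [forall e in M, forall f in M, (e != f) ==> [disjoint val e & val f]].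

Lemma matching_vertex_subproof (G : sgraph) (e : edge G) :
  [set e] \in [set M | @is_matching G M].
Proof.
rewrite inE; apply/forall_inP => a /set1P ->.
by apply/forall_inP => b /set1P ->; rewrite eqxx.
Qed.

Lemma matching_sub_subproof (G : sgraph) (A B : {set edge G}) :
  A \subset B -> B \in [set M | @is_matching G M] ->
  A \in [set M | @is_matching G M].
Proof.
move=> /subsetP sAB; rewrite !inE => /forall_inP mB.
apply/forall_inP => e /sAB /mB /forall_inP me.
by apply/forall_inP => f /sAB /me.
Qed.

Definition matching_complex (G : sgraph) : simplicial_complex (edge G) :=
  SimplicialComplex (@matching_vertex_subproof G) (@matching_sub_subproof G).

(** Central vertices are [inl i]; the [j]-th leg at [inl i] is
    [inr (Tagged _ j)] with tag [i]. *)
Section Caterpillar.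
Variables (n : nat) (m : 'I_n -> nat).

Definition caterpillar_vertex : finType := ('I_n + {i : 'I_n & 'I_(m i)})%type.

Definition caterpillar_adj : rel caterpillar_vertex := fun u v =>
  match u, v with
  | inl i, inl j => (j == i.+1 :> nat) || (i == j.+1 :> nat)
  | inl i, inr l | inr l, inl i => tag l == i
  | inr _, inr _ => false
  end.

Lemma caterpillar_sym_subproof : symmetric caterpillar_adj.
Proof. by move=> [i|l] [j|l'] //=; rewrite orbC. Qed.

Lemma caterpillar_irrefl_subproof : irreflexive caterpillar_adj.
Proof. by move=> [i|l] //=; rewrite orbb eqn_leq ltnn andbF. Qed.

Definition caterpillar : sgraph :=
  SGraph caterpillar_sym_subproof caterpillar_irrefl_subproof.

End Caterpillar.

(** The block {p, p+1}. Positions 1, ..., n are represented by 'I_n, shifted to start at 0. *)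
Definition is_block (n : nat) (b : {set 'I_n}) : bool :=
  [exists p : 'I_n, exists q : 'I_n, (q == p.+1 :> nat) && (b == [set p; q])].

(** The set A_x^n. [#|B|.*2 == n - x] makes the disjoint blocks cover the unmarked positions
    exactly, and rules out odd [n - x]. *)
Definition marked_sequences (n x : nat) : {set x.-tuple 'I_n} :=
  [set s : x.-tuple 'I_n |
    sorted ltn (map val s) &&
    [exists B : {set {set 'I_n}},
      [&& [forall b in B, is_block b], trivIset B, #|B|.*2 == n - x
        & [set i | i \notin s] \subset cover B]]].

Definition marked_sum (n x : nat) (t : 'I_n -> nat) : nat :=
  \sum_(s in marked_sequences n x) \prod_(i <- s) t i.

From mathcomp Require Import all_classical all_reals all_analysis.
From mathcomp Require Import homotopy.
Import Order.TTheory GRing.Theory Num.Theory.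
Import numFieldNormedType.Exports.
Local Open Scope classical_set_scope.
Local Open Scope ring_scope.

Definition homotopic (R : realType) (X Y : topologicalType) (f g : X -> Y) :=
  exists H : R * X -> Y,
    [/\ {within `[0, 1] `*` [set: X], continuous H},
        forall x, H (0, x) = f x & forall x, H (1, x) = g x].

Definition homotopy_equivalent (R : realType) (X Y : topologicalType) :=
  exists (f : X -> Y) (g : Y -> X),
    [/\ continuous f, continuous g,
        homotopic R (g \o f) idfun & homotopic R (f \o g) idfun].

(** Geometric realization in barycentric coordinates; the vertex set is
    finite, so the product topology on coordinates is the Euclidean one. *)
Definition realization_set (R : realType) (V : finType)
    (K : simplicial_complex V) : set {ptws V -> R} :=
  [set x : {ptws V -> R} |
    [/\ forall v, 0 <= x v, \sum_(v : V) x v = 1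
      & finset (fun v => x v != 0) \in faces K]].

Definition realization (R : realType) (V : finType)
  (K : simplicial_complex V) : topologicalType :=
  set_type (@realization_set R V K).

(** The unit sphere S^d of the Euclidean space R^(d+1). *)
Definition sphere_set (R : realType) (d : nat) : set 'rV[R]_d.+1 :=
  [set x : 'rV[R]_d.+1 | \sum_(i < d.+1) x ord0 i ^+ 2 = 1].

Definition sphere (R : realType) (d : nat) : Type := set_type (@sphere_set R d).

HB.instance Definition _ (R : realType) (d : nat) :=
  Topological.copy (sphere R d) (set_type (@sphere_set R d)).

Lemma sphere_base_subproof (R : realType) (d : nat) :
  (delta_mx ord0 ord0 : 'rV[R]_d.+1) \in @sphere_set R d.
Proof.
rewrite inE /sphere_set /= (bigD1 ord0) //= mxE !eqxx expr1n big1 ?addr0 //.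
by move=> i i0; rewrite mxE (negbTE i0) andbF expr0n.
Qed.

HB.instance Definition _ (R : realType) (d : nat) :=
  isPointed.Build (sphere R d)
    (exist (fun x => x \in @sphere_set R d) _ (@sphere_base_subproof R d)).

HB.instance Definition _ := Topological.copy unit (discrete_topology unit).

(** The library wedge of an empty family is empty. A one-point summand,
    indexed by [None], makes the empty wedge a point and changes nothing
    otherwise. *)
Definition bouquet (I : choiceType) (X : I -> ptopologicalType) :
    ptopologicalType :=
  pwedge (fun o : option I => if o is Some i then X i else unit).

(* Main.v *)
(** The first legs [w_1, ..., w_n] at the central vertices form a simplex of
    [M(G)].  Call a face a cone face if some [w_i] can be added to it, and let
    [L] be the subcomplex of cone faces.  The other faces are the matchings
    that cover every central vertex without using a first leg; these are facets.

    [L] is contracted inside [M(G)] by an explicit deformation: small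
    coordinates are truncated to [0], the rest of the mass is moved to those
    [w_i] compatible with what survives, and finally to a single [w_i].  All
    formulas make sense on the whole of [M(G)], so no homotopy extension
    argument is needed, and the deformation descends to [M(G)/L].  This quotient
    is the wedge with one sphere [S^(d)] per critical facet of dimension [d].

    A critical facet is a set of marked positions, a leg other than the first
    one at each marked position, and a tiling of the unmarked positions by
    central edges.  Tilings are unique, so the number of critical facets with
    [x] marks is [M_x^n]; such a facet has [(n + x) / 2] edges. *)

Require Import Defs.
From mathcomp Require Import all_boot all_order all_algebra.
From mathcomp Require Import all_classical all_reals all_analysis.
From mathcomp Require Import generic_quotient homotopy ring lra zify.
Set Implicit Arguments.
Unset Strict Implicit.
Unset Printing Implicit Defensive.
Import Order.TTheory GRing.Theory Num.Theory numFieldNormedType.Exports.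
Local Open Scope ring_scope.

Local Open Scope classical_set_scope.

(** * Realizations of simplicial complexes *)

(** This says that [id * f] is a quotient map, which is what lets homotopies descend along [f]. Fix
    [(t, b)]. Around a point of the fibre over [b] the continuity upstairs gives a product
    neighbourhood; around any other point Hausdorff separation makes [f x = p.2] fail nearby.
    Compactness makes these choices uniform in [x]. *)
Lemma compact_quotient_continuous (T K B Y : topologicalType) (f : K -> B)
    (h : T * B -> Y) :
  compact [set: K] -> hausdorff_space B -> continuous f ->
  (forall b, exists x, f x = b) ->
  continuous (fun p : T * K => h (p.1, f p.2)) -> continuous h.
Proof.
move=> /compact_near_coveringP cK hB cf fsurj ch [t b] U nU.
have := cK (T * B)%type (nbhs (t, b))
  (fun p x => f x = p.2 -> U (h p)) _.
case.
  move=> x _ /=.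
  have [fx|fx] := pselect (f x = b).
    have := ch (t, x) U; rewrite /= fx => /(_ nU) [[P Q] /= [Pt Qx] PQ].
    exists (Q, (P `*` setT)) => //=.
      split => //; exists (P, setT) => //=; split => //; exact: filterT.
    move=> [x' [t' b']] /= [Qx' [Pt' _]] <-.
    exact: (PQ (t', x')).
  have : exists A C, [/\ nbhs (f x) A, nbhs b C & A `&` C = set0].
    apply: contrapT => nAC; apply: fx; apply: hB => A C nA nC.
    by apply/set0P/eqP => AC; apply: nAC; exists A, C.
  move=> [A [C [nA nC AC]]].
  exists (f @^-1` A, setT `*` C) => /=.
    split; first exact: cf.
    by exists (setT, C) => //=; split => //; exact: filterT.
  move=> [x' [t' b']] /= [Ax' [_ Cb']] E.
  have : (A `&` C) (f x') by split => //; rewrite E.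
  by rewrite AC.
move=> [P Q] [Pt Qb] PQ; exists (P, Q) => // -[t' b'] PQ'.
move: PQ'; have [x <-] := fsurj b' => PQ'.
exact: (PQ (t', f x) PQ' x).
Qed.

(** * Continuity of real-valued expressions *)

Section RealValued.
Context {R : realType} {X : topologicalType} {I : finType} (P : pred I).
Variable F : I -> X -> R.
Hypothesis cF : forall i, P i -> continuous (F i).

Lemma continuous_sum : continuous (fun x => \sum_(i | P i) F i x).
Proof.
by apply: continuous_big => // z; apply: cvgD; [exact: cvg_fst|exact: cvg_snd].
Qed.

Lemma continuous_prod : continuous (fun x => \prod_(i | P i) F i x).
Proof. by apply: continuous_big => // z; exact: mul_continuous. Qed.

Lemma continuous_bigmin (x0 : R) :
  continuous (fun x => \big[Num.min/x0]_(i | P i) F i x).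
Proof.
apply: continuous_big => // z; apply: continuous_min.
  exact: cvg_fst.
exact: cvg_snd.
Qed.

End RealValued.

Section RealValuedPair.
Context {R : realType} {X : topologicalType} (f g : X -> R).
Hypotheses (cf : continuous f) (cg : continuous g).

Lemma continuous_add : continuous (fun x => f x + g x).
Proof. by move=> x; apply: cvgD; [exact: cf|exact: cg]. Qed.

Lemma continuous_sub : continuous (fun x => f x - g x).
Proof. by move=> x; apply: cvgB; [exact: cf|exact: cg]. Qed.

Lemma continuous_mul : continuous (fun x => f x * g x).
Proof. by move=> x; apply: cvgM; [exact: cf|exact: cg]. Qed.

Lemma continuous_div : (forall x, g x != 0) -> continuous (fun x => f x / g x).
Proof. by move=> g0 x; apply: cvgM; [exact: cf|apply: cvgV; [exact: g0|exact: cg]]. Qed.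

Lemma continuous_minr : continuous (fun x => Num.min (f x) (g x)).
Proof. by move=> x; apply: continuous_min; [exact: cf|exact: cg]. Qed.

Lemma continuous_maxr : continuous (fun x => Num.max (f x) (g x)).
Proof. by move=> x; apply: continuous_max; [exact: cf|exact: cg]. Qed.

End RealValuedPair.

Lemma continuous_cst (R : realType) (X : topologicalType) (r : R) :
  continuous ((fun=> r) : X -> R).
Proof. by move=> x; exact: cvg_cst. Qed.

(** * Barycentric coordinates and compactness of the realization *)

Section Coordinates.
Context {R : realType} {V : finType} {K : simplicial_complex V}.
Implicit Types x y : realization R K.

Definition bary x : V -> R := set_val x.

Definition supp x : {set V} := finset (fun v => bary x v != 0).

Lemma bary_ge0 x v : 0 <= bary x v.
Proof. by have [+ _ _] := set_mem (valP x); exact. Qed.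

Lemma bary_sum x : \sum_v bary x v = 1.
Proof. by have [_ + _] := set_mem (valP x). Qed.

Lemma supp_face x : supp x \in faces K.
Proof. by have [_ _ +] := set_mem (valP x). Qed.

Lemma bary_inj x y : (forall v, bary x v = bary y v) -> x = y.
Proof. by move=> xy; apply: val_inj; apply/funext. Qed.

Lemma in_supp x v : (v \in supp x) = (0 < bary x v).
Proof. by rewrite inE lt0r bary_ge0 andbT. Qed.

Definition in_realization (z : V -> R) :=
  [/\ forall v, 0 <= z v, \sum_v z v = 1 & finset (fun v => z v != 0) \in faces K].

Definition to_realization (z : V -> R) (zK : in_realization z) : realization R K :=
  exist _ (z : {ptws V -> R}) (mem_set (zK : realization_set K z)).

Lemma bary_continuous v : continuous (bary^~ v).
Proof.
move=> x; apply: (@continuous_comp _ _ _ set_val (fun z : {ptws V -> R} => z v)).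
  exact: initial_continuous.
exact: (@proj_continuous V (fun _ => R) v).
Qed.

Lemma realization_continuous (X : topologicalType) (f : X -> realization R K) :
  (forall v, continuous (fun p => bary (f p) v)) -> continuous f.
Proof.
move=> cf; apply: continuous_comp_initial => p.
apply/cvg_sup => v U [_ [[W oW <-] Wfp] WU].
by apply: (filterS WU); apply: (cf v p); exact: open_nbhs_nbhs.
Qed.

Lemma realization_set_compact : compact (@realization_set R V K).
Proof.
pose box := [set z : {ptws V -> R} | forall v, `[0 : R, 1 : R]%classic (z v)].
apply: (@subclosed_compact _ _ box); last 2 first.
- by apply: (@tychonoff V (fun=> R) (fun=> `[0 : R, 1 : R]%classic)) => v;
  exact: segment_compact.
- move=> z [z0 z1 _] v /=; rewrite in_itv /= z0 /= -z1 (bigD1 v) //= lerDl.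
  exact: sumr_ge0.
have cproj v : continuous (fun z : {ptws V -> R} => z v).
  exact: (@proj_continuous V (fun _ => R) v).
(* The support condition becomes closed once rewritten with monomials: a support is a face exactly
   when the product of the coordinates over each non-face vanishes. *)
have -> : @realization_set R V K =
    (\bigcap_v [set z | 0 <= z v]) `&` [set z | \sum_v z v = 1]
    `&` \bigcap_(A in [set A | A \notin faces K]) [set z | \prod_(v in A) z v = 0].
  rewrite eqEsubset; split => z /=.
    move=> [z0 z1 zK]; split; first by split => // v _; exact: z0.
    move=> A /= nAK; apply/eqP; apply: contraNT nAK => /prodf_neq0 nz.
    by apply: faces_sub zK; apply/fintype.subsetP => v /nz; rewrite inE.
  move=> [[z0 z1] zK]; split => //; first by move=> v; exact: z0.
  apply: contrapT => /negP /zK /eqP; apply/negP/prodf_neq0 => v.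
  by rewrite inE.
apply: closedI; [apply: closedI|].
- apply: closed_bigI => v _.
  apply: (@closed_comp _ _ (fun z : {ptws V -> R} => z v) [set r | 0 <= r]).
    by move=> z _; exact: cproj.
  exact: closed_ge.
- apply: (@closed_comp _ _ (fun z : {ptws V -> R} => \sum_v z v) [set 1]);
  last exact: closed_eq.
  move=> z _; by apply: (@continuous_sum _ _ _ _ (fun v (z : {ptws V -> R}) => z v))
    => v _; exact: cproj.
- apply: closed_bigI => A _.
  apply: (@closed_comp _ _ (fun z : {ptws V -> R} => \prod_(v in A) z v) [set 0]);
    last exact: closed_eq.
  move=> z _; by apply: (@continuous_prod _ _ _ _ (fun v (z : {ptws V -> R}) => z v))
    => v _; exact: cproj.
Qed.

Lemma realization_compact : compact [set: realization R K].
Proof.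
apply/compact_near_coveringP => I F P FF cov.
have /compact_near_coveringP cK := realization_set_compact.
(* Quantifying over all [x] with value [z] turns a predicate on the subtype into one on the ambient
   function space. *)
apply: filterS (cK I F (fun i z => forall x : realization R K,
  set_val x = z -> P i x) FF _).
  by move=> i Pi x _; apply: (Pi (set_val x)) => //; exact: set_mem (valP x).
move=> z zK; pose x0 : realization R K := exist _ z (mem_set zK).
have [[U J] /= [Ux0 FJ] UJ] := cov x0 Logic.I.
have [_ [[W oW <-] /= Wx0] WU] := Ux0.
exists (W, J) => //=; first by split => //; exact: open_nbhs_nbhs.
move=> [z' i] /= [Wz' Ji] x xz'; apply: (UJ (x, i)); split => //=.
by apply: WU => /=; rewrite xz'.
Qed.

End Coordinates.

Arguments in_realization {R V} K z.

(** * Collapsing the boundary of a facet onto a sphere *)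

Section Sphere.
Context {R : realType} {d : nat}.

Definition scoord (s : sphere R d) (i : 'I_d.+1) : R :=
  (set_val s : 'rV[R]_d.+1) ord0 i.

Lemma scoord_sqr_sum s : \sum_i scoord s i ^+ 2 = 1.
Proof. exact: set_mem (valP s). Qed.

Lemma scoord_inj s s' : (forall i, scoord s i = scoord s' i) -> s = s'.
Proof. by move=> ss'; apply: val_inj; apply/rowP. Qed.

Lemma scoord_point i : scoord point i = (i == ord0)%:R.
Proof. by rewrite /scoord /= mxE eqxx. Qed.

Definition to_sphere (u : 'I_d.+1 -> R) (u1 : \sum_i u i ^+ 2 = 1) : sphere R d.
Proof.
exists (\row_i u i); apply: mem_set; rewrite /sphere_set /= -[RHS]u1.
by apply: eq_bigr => i _; rewrite mxE.
Defined.

Lemma to_sphereE u u1 i : scoord (@to_sphere u u1) i = u i.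
Proof. by rewrite /scoord /= mxE. Qed.

Lemma sphere_continuous (X : topologicalType) (f : X -> sphere R d) :
  (forall i, continuous (fun p => scoord (f p) i)) -> continuous f.
Proof.
move=> cf; apply: continuous_comp_initial.
rewrite (_ : _ \o f = fun p => \sum_i scoord (f p) i *: (delta_mx 0 i : 'rV[R]_d.+1)).
  apply: continuous_big => [z|i _ p].
    by apply: cvgD; [exact: cvg_fst|exact: cvg_snd].
  apply: cvgZl; exact: cf.
by apply/funext => p /=; rewrite [LHS]row_sum_delta.
Qed.

Lemma sphere_hausdorff : hausdorff_space (sphere R d).
Proof.
move=> s s' ss'; apply: val_inj; apply: (@norm_hausdorff R 'rV[R]_d.+1) => A B nA nB.
have cval : continuous (fun u : sphere R d => set_val u : 'rV[R]_d.+1).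
  exact: initial_continuous.
have [s'' [sA sB]] := ss' _ _ (cval _ _ nA) (cval _ _ nB).
by exists (set_val s'').
Qed.

Lemma sphere_pole s : (s == point) = (scoord s ord0 == 1).
Proof.
apply/eqP/eqP => [->|s0]; first by rewrite scoord_point.
apply: scoord_inj => i; rewrite scoord_point; have [-> //|i0] := eqVneq.
have := scoord_sqr_sum s; rewrite (bigD1 ord0) //= s0 expr1n.
move=> /(canRL (addKr 1)); rewrite addNr.
move=> /psumr_eq0P H; apply/eqP; rewrite -sqrf_eq0 H // => j _; exact: sqr_ge0.
Qed.

Lemma scoord_pole_lt s : s != point -> scoord s ord0 < 1.
Proof.
rewrite sphere_pole => s0; rewrite lt_neqAle s0 /=.
have : scoord s ord0 ^+ 2 <= 1.
  by rewrite -(scoord_sqr_sum s) (bigD1 ord0) //= lerDl sumr_ge0 // => i _;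
    exact: sqr_ge0.
nra.
Qed.

End Sphere.

(** * The map that pinches the complement of an open facet to the pole *)

Section SphereOfSimplex.
Context {R : realType} {V : finType} {K : simplicial_complex V} {d : nat}.
Variable (vtx : 'I_d.+1 -> V).
Hypothesis vtx_inj : injective vtx.

Definition facet : {set V} := [set vtx j | j : 'I_d.+1].

Hypothesis facet_face : facet \in faces K.
Hypothesis facet_max : forall A, A \in faces K -> facet \subset A -> A = facet.
Implicit Types x y : realization R K.

(* The interior of the facet is identified with [R^d] by
   [offset x j / min_coord x], [j != 0], and then with the sphere minus a pole by
   inverse stereographic projection.  [outer_mass] vanishes where [min_coord] is
   positive, and keeps the denominator positive outside the facet. *)
Definition min_coord x : R := \big[Num.min/1]_j bary x (vtx j).
Definition offset x j : R := bary x (vtx j) - bary x (vtx ord0).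
Definition outer_mass x : R := 1 - \sum_j bary x (vtx j).
Definition boundary_gap x : R := \sum_j offset x j ^+ 2 + outer_mass x ^+ 2.
Definition pinch_denom x : R := boundary_gap x + min_coord x ^+ 2.
Definition pinch_coord x j : R :=
  (if j == ord0 then boundary_gap x - min_coord x ^+ 2
   else offset x j * min_coord x *+ 2) / pinch_denom x.

Lemma bary_le1 x v : bary x v <= 1.
Proof.
by rewrite -(bary_sum x) (bigD1 v) //= lerDl sumr_ge0 // => w _; exact: bary_ge0.
Qed.

Lemma min_coord_attained x : exists j, min_coord x = bary x (vtx j).
Proof.
have le1 j : true -> bary x (vtx j) <= 1 by move=> _; exact: bary_le1.
have [j _ E] := eq_bigmin (x := 1) ord0 xpredT (fun j => bary x (vtx j)) isT le1.
by exists j; rewrite -E.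
Qed.

Lemma min_coord_le x j : min_coord x <= bary x (vtx j).
Proof. exact: bigmin_le. Qed.

Lemma min_coord_ge0 x : 0 <= min_coord x.
Proof. by have [j ->] := min_coord_attained x; exact: bary_ge0. Qed.

(** Positivity forces the support to contain the facet, and maximality upgrades the inclusion to an
    equality. *)
Lemma min_coord_gt0 x : (0 < min_coord x) = (supp x == facet).
Proof.
apply/idP/eqP => [x0|xF].
  apply: facet_max; first exact: supp_face.
  apply/fintype.subsetP => _ /imsetP [j _ ->]; rewrite in_supp.
  exact: lt_le_trans (min_coord_le x j).
have [j ->] := min_coord_attained x.
by rewrite -in_supp xF imset_f.
Qed.

Lemma facet_sum x : supp x = facet -> \sum_j bary x (vtx j) = 1.
Proof.
move=> xF; rewrite -(bary_sum x) [RHS](bigID (mem facet)) /= [X in _ = _ + X]big1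
  ?addr0.
  by rewrite big_imset //= => i j _ _; exact: vtx_inj.
by move=> v; rewrite -xF in_supp -leNgt => v0; apply: le_anti; rewrite v0 bary_ge0.
Qed.

Lemma outer_mass_min x : outer_mass x * min_coord x = 0.
Proof.
have := min_coord_ge0 x; rewrite le0r => /orP [/eqP ->|]; first by rewrite mulr0.
by rewrite min_coord_gt0 => /eqP /facet_sum xF; rewrite /outer_mass xF subrr mul0r.
Qed.

Lemma boundary_gap_ge0 x : 0 <= boundary_gap x.
Proof. by rewrite addr_ge0 ?sqr_ge0 // sumr_ge0 // => j _; exact: sqr_ge0. Qed.

(** If the denominator vanished, all coordinates on the facet would be equal and their minimum 0, so
    the facet would carry no mass; but then [outer_mass x] is 1, not 0. *)
Lemma pinch_denom_gt0 x : 0 < pinch_denom x.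
Proof.
rewrite lt0r addr_ge0 ?sqr_ge0 ?boundary_gap_ge0 // andbT.
apply/negP; rewrite paddr_eq0 ?sqr_ge0 ?boundary_gap_ge0 // sqrf_eq0.
rewrite paddr_eq0 ?sqr_ge0 ?sumr_ge0 //; last by move=> *; exact: sqr_ge0.
rewrite sqrf_eq0 psumr_eq0; last by move=> *; exact: sqr_ge0.
case/andP => /andP [/allP off /eqP out] /eqP mu0.
have cst j : bary x (vtx j) = bary x (vtx ord0).
  have /implyP := off j (mem_index_enum _); rewrite sqrf_eq0 subr_eq0.
  by move=> /(_ isT) /eqP.
have [k muk] := min_coord_attained x.
move/eqP: out; rewrite subr_eq0 big1 ?oner_eq0 // => j _.
by rewrite cst -(cst k) -muk.
Qed.

(** With g the gap, m the minimum and o the outer mass, the identity is (g - m^2)^2 + 4 m^2 (g -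
    o^2) = (g + m^2)^2, which holds because o m = 0. *)
Lemma pinch_sphere x : \sum_i pinch_coord x i ^+ 2 = 1.
Proof.
have q0 := lt0r_neq0 (pinch_denom_gt0 x).
rewrite (bigD1 ord0) //= {1}/pinch_coord eqxx.
rewrite (eq_bigr (fun i => offset x i ^+ 2 * ((min_coord x *+ 2) ^+ 2 / pinch_denom x
  ^+ 2))); last first.
  by move=> i /negbTE i0; rewrite /pinch_coord i0; field.
rewrite -big_distrl /=.
have -> : \sum_(i | i != ord0) offset x i ^+ 2 = boundary_gap x - outer_mass x ^+ 2.
  rewrite /boundary_gap addrK [RHS](bigD1 ord0) //= /offset subrr expr0n /= add0r.
  by [].
have om := outer_mass_min x.
have om2 : outer_mass x ^+ 2 * min_coord x ^+ 2 = 0 by rewrite -exprMn om expr0n.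
apply: (mulIf (expf_neq0 2 q0)).
rewrite mulrDl expr_div_n mulfVK ?expf_neq0 // mulrA mulfVK ?expf_neq0 // mul1r.
rewrite /pinch_denom; nra.
Qed.

Definition pinch x : sphere R d := to_sphere (pinch_sphere x).

Lemma pinch_continuous : continuous pinch.
Proof.
have cb v : continuous (fun x : realization R K => bary x v) by exact: bary_continuous.
have cmin : continuous min_coord by apply: continuous_bigmin => j _; exact: cb.
have coff j : continuous (offset ^~ j) by exact: continuous_sub.
have cout : continuous outer_mass.
  apply: continuous_sub; first exact: continuous_cst.
  exact: (continuous_sum (fun j _ => cb (vtx j))).
have sqr (f : realization R K -> R) : continuous f -> continuous (fun x => f x ^+ 2).
  by move=> cf; exact: continuous_mul.
have cgap : continuous boundary_gap.
  apply: continuous_add; last exact: sqr.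
  exact: (continuous_sum (fun j _ => sqr _ (coff j))).
apply: sphere_continuous => i.
rewrite (_ : (fun p => _) = pinch_coord ^~ i); last by apply/funext => p;
  exact: to_sphereE.
apply: continuous_div; last by move=> x; exact: lt0r_neq0 (pinch_denom_gt0 x).
  case: eqP => _; first by apply: continuous_sub => //; exact: sqr.
  by apply: continuous_add; exact: continuous_mul.
by apply: continuous_add => //; exact: sqr.
Qed.

Lemma pinch_pole x : (pinch x == point) = (supp x != facet).
Proof.
rewrite sphere_pole to_sphereE /pinch_coord eqxx -min_coord_gt0.
rewrite lt0r min_coord_ge0 andbT negbK.
have q0 := lt0r_neq0 (pinch_denom_gt0 x).
rewrite -(inj_eq (mulIf q0)) mulfVK // mul1r /pinch_denom.
apply/eqP/eqP => [|->]; last by rewrite expr0n /= subr0 addr0.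
move=> E; apply/eqP; rewrite -sqrf_eq0; apply/eqP; lra.
Qed.

(** The sphere coordinates determine the ratios [offset / min_coord], hence the ratios
    [bary / min_coord] up to a common constant. The minimum fixes the constant and the total mass
    fixes the scale. *)
Lemma pinch_inj x y : supp x = facet -> supp y = facet ->
  pinch x = pinch y -> x = y.
Proof.
move=> xF yF xy.
have mx : 0 < min_coord x by rewrite min_coord_gt0 xF.
have my : 0 < min_coord y by rewrite min_coord_gt0 yF.
have qx := pinch_denom_gt0 x; have qy := pinch_denom_gt0 y.
have xyc i : pinch_coord x i = pinch_coord y i.
  by rewrite -!(to_sphereE (pinch_sphere _)); congr scoord.
have s_xy : min_coord x ^+ 2 / pinch_denom x = min_coord y ^+ 2 / pinch_denom y.
  have := xyc ord0; rewrite /pinch_coord eqxx.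
  have gE z : boundary_gap z = pinch_denom z - min_coord z ^+ 2 by rewrite addrK.
  rewrite !gE !mulrBl !divff ?lt0r_neq0 //; lra.
have off_xy i : offset x i / min_coord x = offset y i / min_coord y.
  have [->|i0] := eqVneq i ord0; first by rewrite /offset !subrr !mul0r.
  have := xyc i; rewrite /pinch_coord (negbTE i0).
  have -> : offset x i * min_coord x *+ 2 / pinch_denom x =
    offset x i / min_coord x * (min_coord x ^+ 2 / pinch_denom x) *+ 2.
    by field; rewrite !lt0r_neq0.
  have -> : offset y i * min_coord y *+ 2 / pinch_denom y =
    offset y i / min_coord y * (min_coord y ^+ 2 / pinch_denom y) *+ 2.
    by field; rewrite !lt0r_neq0.
  rewrite s_xy => /eqP; rewrite eqrMn2r /= => /eqP; apply: mulIf.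
  by rewrite mulf_neq0 ?expf_neq0 ?invr_neq0 ?lt0r_neq0.
pose c := bary x (vtx ord0) / min_coord x - bary y (vtx ord0) / min_coord y.
have xE i : bary x (vtx i) / min_coord x = bary y (vtx i) / min_coord y + c.
  have := off_xy i; rewrite /offset !mulrBl /c; lra.
(* Both families of ratios have least value 1, so the constant by which they differ is 0. *)
have c0 : c = 0.
  have [j jx] := min_coord_attained x; have [k ky] := min_coord_attained y.
  have := xE j; have := xE k.
  rewrite -{1}jx -{1}ky !divff ?lt0r_neq0 //.
  have : 1 <= bary x (vtx k) / min_coord x by rewrite ler_pdivlMr // mul1r min_coord_le.
  have : 1 <= bary y (vtx j) / min_coord y by rewrite ler_pdivlMr // mul1r min_coord_le.
  lra.
(* Over the facet the ratios sum to the inverse of [min_coord]. *)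
have mxy : min_coord x = min_coord y.
  apply: invr_inj; rewrite -[LHS]mul1r -[RHS]mul1r.
  rewrite -{1}(facet_sum xF) -(facet_sum yF) !mulr_suml.
  by apply: eq_bigr => i _; rewrite xE c0 addr0.
apply: bary_inj => v; have [/imsetP [i _ ->]|vF] := boolP (v \in facet).
  have := xE i; rewrite c0 addr0 mxy; apply: mulIf.
  by rewrite invr_neq0 ?lt0r_neq0.
have out z : supp z = facet -> bary z v = 0.
  by move=> zF; move: vF; rewrite -zF inE negbK => /eqP.
by rewrite !out.
Qed.

Lemma pinch_surj s : s != point -> exists2 x, supp x = facet & pinch x = s.
Proof.
move=> /scoord_pole_lt s0.
(* These are the stereographic coordinates of [s], extended by 0 at [ord0] where [offset] vanishes.
   Shifting by [1 - m] brings the least one to 1, and dividing by the sum [S] gives total mass 1. *)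
pose y j := if j == ord0 then 0 else scoord s j / (1 - scoord s ord0).
(* The default 0 is harmless: it is the value [y ord0]. *)
pose m := \big[Num.min/0]_j y j.
have m_le j : m <= y j by exact: bigmin_le.
have [k mk] : exists k, m = y k.
  have : m <= m by []; rewrite {1}/m => /bigmin_leP [m0|[k _ km]].
    by exists ord0; apply: le_anti; rewrite m_le /y eqxx.
  by exists k; apply: le_anti; rewrite m_le.
have zk : y k + 1 - m = 1 by rewrite mk; ring.
pose S := \sum_j (y j + 1 - m).
have z_gt0 j : 0 < y j + 1 - m by have := m_le j; lra.
have S_ge1 : 1 <= S.
  rewrite /S (bigD1 k) //= zk lerDl sumr_ge0 // => j _.
  exact: ltW.
have S_gt0 : 0 < S by lra.
pose z v := \sum_(j | vtx j == v) (y j + 1 - m) / S.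
have zE i : z (vtx i) = (y i + 1 - m) / S.
  by rewrite /z (eq_bigl (pred1 i)) ?big_pred1_eq // => j; rewrite /= (inj_eq vtx_inj).
have z_out v : v \notin facet -> z v = 0.
  move=> vF; rewrite /z big_pred0 // => j; apply: contraNF vF => /eqP <-.
  exact: imset_f.
have zsupp v : (z v != 0) = (v \in facet).
  have [/imsetP [i _ ->]|/z_out ->] := boolP (v \in facet); last by rewrite eqxx.
  by rewrite zE lt0r_neq0 // divr_gt0.
have zK : in_realization K z.
  split.
  - by move=> v; rewrite sumr_ge0 // => j _; rewrite ltW // divr_gt0.
  - rewrite (bigID (mem facet)) /= [X in _ + X]big1; last by move=> v /z_out.
    rewrite addr0 big_imset /=; last by move=> i j _ _; exact: vtx_inj.
    under eq_bigr do rewrite zE.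
    by rewrite -mulr_suml divff // lt0r_neq0.
  - by rewrite (_ : finset _ = facet) //; apply/setP => v; rewrite inE zsupp.
pose x : realization R K := to_realization zK.
have xE j : bary x (vtx j) = (y j + 1 - m) / S by exact: zE.
have xF : supp x = facet by apply/setP => v; rewrite inE -zsupp.
exists x => //; apply: scoord_inj => i; rewrite to_sphereE.
have muE : min_coord x = S^-1.
  have : min_coord x <= S^-1.
    by apply: le_trans (min_coord_le x k) _; rewrite xE zk mul1r.
  have [j ->] := min_coord_attained x; rewrite xE => yS; apply: le_anti.
  by rewrite yS /= -{1}[S^-1]mul1r ler_pM2r ?invr_gt0 //; have := m_le j; lra.
have offE j : offset x j = y j / S.
  by rewrite /offset !xE {2}/y eqxx; field; exact: lt0r_neq0.
have s1 : 1 - scoord s ord0 != 0 by rewrite lt0r_neq0 // subr_gt0.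
have gapE : boundary_gap x = (1 + scoord s ord0) / (1 - scoord s ord0) / S ^+ 2.
  rewrite /boundary_gap /outer_mass facet_sum // subrr expr0n addr0.
  under eq_bigr do rewrite offE expr_div_n.
  rewrite -mulr_suml; congr (_ / _).
  rewrite (bigD1 ord0) //= /y eqxx expr0n add0r.
  rewrite (eq_bigr (fun j => scoord s j ^+ 2 / (1 - scoord s ord0) ^+ 2)); last first.
    by move=> j /negbTE ->; rewrite expr_div_n.
  have := scoord_sqr_sum s; rewrite (bigD1 ord0) //= => /(canRL (addKr _)) E.
  by rewrite -mulr_suml E; field.
have S0 := lt0r_neq0 S_gt0.
rewrite /pinch_coord /pinch_denom offE gapE muE; case: eqP => [->|/eqP/negbTE i0].
  by field; rewrite S0 s1 /=; apply/negP => /eqP; lra.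
rewrite /y i0; field; rewrite S0 s1 /=; apply/negP => /eqP; lra.
Qed.

End SphereOfSimplex.

Local Close Scope classical_set_scope.

(** * Deforming the cone faces to a vertex *)

Section Clamp.
Context {R : realType}.

Definition clamp (r : R) : R := Num.min 1 (Num.max 0 r).

Lemma clamp_ge0 r : 0 <= clamp r.
Proof. by rewrite le_min ler01 le_max lexx. Qed.

Lemma clamp_le1 r : clamp r <= 1.
Proof. by rewrite ge_min lexx. Qed.

Lemma clamp0 r : r <= 0 -> clamp r = 0.
Proof. by move=> r0; rewrite /clamp max_l // min_r. Qed.

Lemma clamp1 r : 1 <= r -> clamp r = 1.
Proof. by move=> r1; rewrite /clamp max_r ?min_l //; apply: le_trans r1. Qed.

Lemma clamp_continuous (X : topologicalType) (f : X -> R) :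
  continuous f -> continuous (fun x => clamp (f x)).
Proof.
move=> cf; apply: continuous_minr; first exact: continuous_cst.
by apply: continuous_maxr => //; exact: continuous_cst.
Qed.

End Clamp.

Section Normalize.
Context {R : realType} {V : finType}.
Implicit Types z p q : V -> R.

Definition distr z := (forall v, 0 <= z v) /\ \sum_v z v = 1.

Definition normalize z v := z v / \sum_u z u.

Lemma normalize_distr z : (forall v, 0 <= z v) -> (exists v, 0 < z v) ->
  distr (normalize z).
Proof.
move=> z0 [v zv]; have S0 : 0 < \sum_u z u.
  by rewrite (bigD1 v) //= ltr_wpDr // sumr_ge0.
split; first by move=> u; rewrite divr_ge0 // ltW.
by rewrite -mulr_suml divff // lt0r_neq0.
Qed.

Lemma normalize_neq0 z v : normalize z v != 0 -> z v != 0.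
Proof. by apply: contraNN => /eqP zv; rewrite /normalize zv mul0r. Qed.

Lemma normalize_id z : \sum_v z v = 1 -> normalize z = z.
Proof. by move=> z1; apply/funext => v; rewrite /normalize z1 divr1. Qed.

Lemma distr_convex p q (a : R) : distr p -> distr q -> 0 <= a <= 1 ->
  distr (fun v => (1 - a) * p v + a * q v).
Proof.
move=> [p0 p1] [q0 q1] /andP [a0 a1]; split.
  by move=> v; rewrite addr_ge0 ?mulr_ge0 // subr_ge0.
by rewrite big_split -!mulr_sumr p1 q1 /=; ring.
Qed.

End Normalize.

Section Deformation.
Context {R : realType} {V : finType} {K : simplicial_complex V}.
Variables (W : {set V}) (w0 : V).
Hypothesis w0W : w0 \in W.
Hypothesis flagW : forall A U : {set V}, A \in faces K -> U \subset W ->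
  {in A & U, forall e w, [set e; w] \in faces K} -> A :|: U \in faces K.
Implicit Types (x : realization R K) (A : {set V}).

Definition cone A := [exists w in W, w |: A \in faces K].

(* As [delta * #|V| < 1], truncation at [delta] never kills every coordinate. *)
Let delta : R := (#|V|.+1)%:R^-1.
Definition trunc x v : R := Num.max 0 (bary x v - delta).
Definition blocking x w : R := \sum_(e | [set e; w] \notin faces K) bary x e.
(** For [w] in [W] this is a continuous test of compatibility: it equals [delta] when no vertex of
    the support is incompatible with [w], and it is 0 once such vertices carry mass [delta]. *)
Definition apex x w : R := (w \in W)%:R * Num.max 0 (delta - blocking x w).
(** In units of [delta], a single [w] compatible with the whole support already contributes 1. *)
Definition apex_total x : R := \sum_w apex x w / delta.
(** The factor 2 separates two phases: [fade] is complete when [apex_total] reaches 1/2, where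
    [gather] starts, and [gather] is complete at 1, a value reached on every cone face. *)
Definition fade x : R := clamp (2 * apex_total x).
Definition gather x : R := clamp (2 * apex_total x - 1).

(* [gather x] is nonzero only if [fade x = 1], that is, once all the mass sits on
   the simplex [W]; on cone faces both are [1]. *)
Definition stage1 x : V -> R := normalize (trunc x).
Definition stage2 x : V -> R :=
  normalize (fun v => (1 - fade x) * trunc x v + apex x v).
Definition stage3 x : V -> R :=
  normalize (fun v => (1 - fade x) * trunc x v + (1 - gather x) * apex x v
    + gather x * (v == w0)%:R).

(* The identity at [t = 1], then [stage1], [stage2], [stage3] at
   [t = 2/3, 1/3, 0], with straight lines in between. *)
Definition deform t x v : R :=
  bary x v + clamp (3 * (1 - t)) * (stage1 x v - bary x v)
    + clamp (3 * (1 - t) - 1) * (stage2 x v - stage1 x v)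
    + clamp (3 * (1 - t) - 2) * (stage3 x v - stage2 x v).

Let delta_gt0 : 0 < delta. Proof. by rewrite invr_gt0 ltr0n. Qed.

Lemma trunc_ge0 x v : 0 <= trunc x v. Proof. by rewrite le_max lexx. Qed.

Lemma trunc_neq0 x v : trunc x v != 0 -> delta < bary x v.
Proof.
rewrite /trunc; case: (ltrP 0 (bary x v - delta)) => [|_]; last by rewrite eqxx.
by rewrite subr_gt0.
Qed.

Lemma trunc_gt0 x : exists v, 0 < trunc x v.
Proof.
apply: contrapT => nex.
have le_d v : bary x v <= delta.
  rewrite leNgt; apply/negP => dv; apply: nex; exists v.
  by rewrite lt_max subr_gt0 dv orbT.
have : \sum_v bary x v <= \sum_(v : V) delta by exact: ler_sum.
rewrite bary_sum sumr_const -mulr_natl leNgt /delta ltr_pdivrMr ?ltr0n // mul1r.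
by rewrite ltr_nat ltnSn.
Qed.

Lemma apex_ge0 x w : 0 <= apex x w.
Proof. by rewrite mulr_ge0 // ?ler0n // le_max lexx. Qed.

Lemma apex_neq0 x w : apex x w != 0 ->
  w \in W /\ forall e, [set e; w] \notin faces K -> bary x e < delta.
Proof.
rewrite mulf_eq0 negb_or pnatr_eq0 eqb0 negbK => /andP [wW].
case: (ltrP 0 (delta - blocking x w)) => [|_]; last by rewrite eqxx.
rewrite subr_gt0 => bd _; split => // e eK; apply: le_lt_trans bd.
by rewrite /blocking (bigD1 e) //= lerDl sumr_ge0 // => *; exact: bary_ge0.
Qed.

Lemma cone_blocking x : cone (supp x) ->
  exists w, [/\ w \in W, w |: supp x \in faces K & apex x w = delta].
Proof.
case/exists_inP => w wW wx; exists w; split => //.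
rewrite /apex wW mul1r (_ : blocking x w = 0).
  by rewrite subr0 max_r // ltW.
apply: big1 => e; apply: contraNeq => e0.
apply: faces_sub wx; rewrite finset.subUset !finset.sub1set !in_setU1 eqxx andbT.
by rewrite (_ : e \in supp x) ?orbT // inE.
Qed.

Lemma apex_total_cone x : cone (supp x) -> 1 <= apex_total x.
Proof.
move=> /cone_blocking [w [_ _ xw]]; rewrite /apex_total (bigD1 w) //= xw.
rewrite divff ?lt0r_neq0 // lerDl sumr_ge0 // => u _.
by rewrite divr_ge0 ?apex_ge0 // ltW.
Qed.

Lemma fade_cone x : cone (supp x) -> fade x = 1.
Proof. by move=> /apex_total_cone; rewrite /fade => ?; apply: clamp1; lra. Qed.

Lemma gather_cone x : cone (supp x) -> gather x = 1.
Proof. by move=> /apex_total_cone; rewrite /gather => ?; apply: clamp1; lra. Qed.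

Lemma gather_fade x : gather x != 0 -> fade x = 1.
Proof.
move=> g0; apply: clamp1; rewrite leNgt; apply: contra g0 => ltx.
by apply/eqP/clamp0; lra.
Qed.

(** This keeps the normalization in [stage2] meaningful: if [fade x] is 0 a truncated coordinate
    survives, and otherwise [apex_total x] is nonzero, so some apex weight is positive. *)
Let mix_pos x : exists v, 0 < (1 - fade x) * trunc x v + apex x v.
Proof.
have f1 : 0 <= 1 - fade x by rewrite subr_ge0 clamp_le1.
have [f0|f0] := eqVneq (fade x) 0.
  have [v tv] := trunc_gt0 x; exists v.
  by rewrite f0 subr0 mul1r ltr_wpDr // apex_ge0.
have : apex_total x != 0.
  by apply: contraNneq f0 => E; rewrite /fade E mulr0 clamp0.
rewrite psumr_neq0 => [/hasP [w _ /andP [_]]|w _];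
  last by rewrite divr_ge0 ?apex_ge0 // ltW.
rewrite pmulr_lgt0 ?invr_gt0 // => xw; exists w.
by rewrite ltr_wpDl // mulr_ge0 // trunc_ge0.
Qed.

Lemma stage1_distr x : distr (stage1 x).
Proof. by apply: normalize_distr; [exact: trunc_ge0|exact: trunc_gt0]. Qed.

Lemma stage2_distr x : distr (stage2 x).
Proof.
apply: normalize_distr => [v|]; last exact: mix_pos.
by rewrite addr_ge0 ?apex_ge0 // mulr_ge0 ?trunc_ge0 // subr_ge0 clamp_le1.
Qed.

Lemma stage3_distr x : distr (stage3 x).
Proof.
apply: normalize_distr => [v|].
  by rewrite !addr_ge0 // mulr_ge0 ?apex_ge0 ?trunc_ge0 ?subr_ge0 ?clamp_le1 ?clamp_ge0.
have [g0|g0] := eqVneq (gather x) 0.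
  have [v mv] := mix_pos x; exists v.
  by rewrite g0 mul0r addr0 subr0 mul1r.
exists w0; rewrite eqxx mulr1 ltr_wpDl //.
  by rewrite !addr_ge0 // mulr_ge0 ?apex_ge0 ?trunc_ge0 ?subr_ge0 ?clamp_le1 ?clamp_ge0.
by rewrite lt0r g0 clamp_ge0.
Qed.

Definition mid_carrier x : {set V} :=
  [set v | trunc x v != 0] :|: [set w | apex x w != 0].

Lemma trunc_supp x : finset (fun v => trunc x v != 0) \subset supp x.
Proof.
apply/fintype.subsetP => v; rewrite inE in_supp => /trunc_neq0; exact: lt_trans.
Qed.

(** A vertex that survives truncation has mass above [delta], while a vertex incompatible with an
    active apex has mass below [delta]. So survivors and active apexes are pairwise compatible, and
    [flagW] applies. *)
Lemma mid_carrier_face x : mid_carrier x \in faces K.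
Proof.
apply: flagW.
- exact: faces_sub (trunc_supp x) (supp_face x).
- by apply/fintype.subsetP => w; rewrite inE => /apex_neq0 [].
- move=> e w; rewrite !inE => /trunc_neq0 de /apex_neq0 [_ ew].
  by apply/negPn/negP => /ew; rewrite ltNge (ltW de).
Qed.

Lemma mid_carrier_cone x : cone (supp x) -> cone (mid_carrier x).
Proof.
move=> /cone_blocking [w [wW _ xw]]; apply/exists_inP; exists w => //.
rewrite (finset.setUidPr _) ?mid_carrier_face // finset.sub1set !inE xw.
by rewrite (lt0r_neq0 delta_gt0) orbT.
Qed.

Lemma coneW A : A \subset W -> cone A /\ A \in faces K.
Proof.
move=> AW.
have WK : W \in faces K.
  (* With [A] empty the compatibility condition of [flagW] is vacuous, so [W] itself is a face. *)
  rewrite -[W]finset.set0U; apply: flagW => //; last by move=> e w; rewrite inE.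
  exact: faces_sub (finset.sub0set _) (faces_vertex K w0).
split; last exact: faces_sub WK.
apply/exists_inP; exists w0 => //; apply: faces_sub WK.
by rewrite finset.subUset finset.sub1set w0W.
Qed.

(** Each of the three straight segments has both ends supported in one face: [supp x], then
    [mid_carrier x], then [mid_carrier x] or [W]. Each of these is a cone face whenever [supp x] is,
    so the deformation preserves the cone subcomplex. *)
Lemma deform_carrier t x : exists A, [/\ A \in faces K,
  cone (supp x) -> cone A, distr (deform t x) & forall v, deform t x v != 0 -> v \in A].
Proof.
(* On each unit interval of [s] between 0 and 3 only one clamped weight varies; beyond these bounds
   all are constant, so every real [t] is covered. *)
pose s := 3 * (1 - t).
have bD : distr (bary x) by split; [exact: bary_ge0|exact: bary_sum].
have step (p q : V -> R) a A : A \in faces K -> (cone (supp x) -> cone A) ->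
    distr p -> distr q ->
    (forall v, p v != 0 -> v \in A) -> (forall v, q v != 0 -> v \in A) ->
    deform t x =1 (fun v => (1 - clamp a) * p v + clamp a * q v) ->
    exists B, [/\ B \in faces K, cone (supp x) -> cone B, distr (deform t x)
      & forall v, deform t x v != 0 -> v \in B].
  move=> AK cA pD qD pA qA /funext ->; exists A; split => //.
    by apply: distr_convex => //; rewrite clamp_ge0 clamp_le1.
  move=> v; have [pv|/pA //] := eqVneq (p v) 0.
  by rewrite pv mulr0 add0r mulf_eq0 negb_or => /andP [_ /qA].
have mid1 v : stage1 x v != 0 -> v \in mid_carrier x.
  by move=> /normalize_neq0; rewrite 2!inE => ->.
have mid2 v : stage2 x v != 0 -> v \in mid_carrier x.
  move=> /normalize_neq0; rewrite !inE; apply: contraR.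
  by rewrite negb_or !negbK => /andP [/eqP -> /eqP ->]; rewrite mulr0 addr0.
have xK := supp_face x; have midK := mid_carrier_face x;
  have midC := @mid_carrier_cone x.
have d1 := stage1_distr x; have d2 := stage2_distr x; have d3 := stage3_distr x.
have [s1|s1] := leP s 1.
  apply: (step (bary x) (stage1 x) s (supp x)) => // v.
  - by rewrite inE.
  - by move=> /normalize_neq0 v0; apply: (fintype.subsetP (trunc_supp x)); rewrite inE.
  - rewrite /deform -/s (@clamp0 _ (s - 1)) ?(@clamp0 _ (s - 2)); [ring|lra|lra].
have [s2|s2] := leP s 2.
  apply: (step (stage1 x) (stage2 x) (s - 1) (mid_carrier x)) => // v.
  rewrite /deform -/s (@clamp1 _ s) ?(@clamp0 _ (s - 2)); [ring|lra|lra].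
have E : deform t x =1 (fun v => (1 - clamp (s - 2)) * stage2 x v + clamp (s - 2) *
  stage3 x v).
  by move=> v; rewrite /deform -/s (@clamp1 _ s) ?(@clamp1 _ (s - 1)); [ring|lra|lra].
(* Either gathering has not begun and the last segment is constant, or fading is complete and both
   of its ends live on the simplex [W]. *)
have [g0|g0] := eqVneq (gather x) 0.
  apply: (step (stage2 x) (stage3 x) (s - 2) (mid_carrier x)) => //.
  have -> // : stage3 x = stage2 x.
  by congr normalize; apply/funext => v; rewrite g0 subr0 mul1r mul0r addr0.
have f1 := gather_fade g0.
have [cW WK] := coneW (subxx W).
have apexW v : apex x v != 0 -> v \in W by move=> /apex_neq0 [].
apply: (step (stage2 x) (stage3 x) (s - 2) W) => // v /normalize_neq0.
  by rewrite f1 subrr mul0r add0r; exact: apexW.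
rewrite f1 subrr mul0r add0r; apply: contraR => vW.
have /eqP -> : apex x v == 0 by apply: contraR vW; exact: apexW.
by rewrite mulr0 add0r (_ : v == w0 = false) ?mulr0 //; apply: contraNF vW => /eqP ->.
Qed.

Lemma deform_in_realization t x : in_realization K (deform t x).
Proof.
have [A [AK _ [d0 d1] dA]] := deform_carrier t x; split => //.
by apply: faces_sub AK; apply/fintype.subsetP => v; rewrite inE => /dA.
Qed.

Definition deformation (p : R * realization R K) : realization R K :=
  to_realization (deform_in_realization p.1 p.2).

Lemma deformation_cone t x : cone (supp x) -> cone (supp (deformation (t, x))).
Proof.
have [A [AK cA _ dA]] := deform_carrier t x => /cA /exists_inP [w wW wA].
apply/exists_inP; exists w => //; apply: faces_sub wA; apply: finset.setUS.
by apply/fintype.subsetP => v; rewrite inE => /dA.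
Qed.

Lemma bary_deformation t x v : bary (deformation (t, x)) v = deform t x v.
Proof. by []. Qed.

Lemma deformation1 x : deformation (1, x) = x.
Proof.
apply: bary_inj => v; rewrite bary_deformation /deform subrr mulr0.
by rewrite !clamp0 ?mul0r ?addr0 //; lra.
Qed.

Lemma deformation0_cone x : cone (supp x) -> bary (deformation (0,
  x)) = (fun v => (v == w0)%:R).
Proof.
move=> cx; apply/funext => v; rewrite bary_deformation /deform subr0 mulr1.
rewrite !clamp1 ?mul1r; [|lra..]; rewrite /stage3 fade_cone // gather_cone //.
rewrite subrr (_ : (fun v => _) = fun v => (v == w0)%:R); last first.
  by apply/funext => u; rewrite !mul0r !add0r mul1r.
rewrite normalize_id; first by ring.
by rewrite (bigD1 w0) //= eqxx big1 ?addr0 // => u /negbTE ->.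
Qed.

Lemma deformation_continuous : continuous deformation.
Proof.
have cx v : continuous (fun p : R * realization R K => bary p.2 v).
  move=> p; apply: (@continuous_comp _ _ _ snd (fun x : realization R K => bary x v)).
    exact: cvg_snd.
  exact: bary_continuous.
have cs (r : R) : continuous (fun p : R * realization R K => clamp (3 * (1 - p.1) - r)).
  apply: clamp_continuous; apply: continuous_sub; last exact: continuous_cst.
  apply: continuous_mul; first exact: continuous_cst.
  by apply: continuous_sub; [exact: continuous_cst|move=> p; exact: cvg_fst].
have ctrunc v : continuous (fun p : R * realization R K => trunc p.2 v).
  apply: continuous_maxr; first exact: continuous_cst.
  by apply: continuous_sub => //; exact: continuous_cst.
have capex w : continuous (fun p : R * realization R K => apex p.2 w).
  apply: continuous_mul; first exact: continuous_cst.
  apply: continuous_maxr; first exact: continuous_cst.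
  apply: continuous_sub; first exact: continuous_cst.
  exact: (continuous_sum (fun e _ => cx e)).
have ctotal : continuous (fun p : R * realization R K => 2 * apex_total p.2).
  apply: continuous_mul; first exact: continuous_cst.
  apply: (@continuous_sum _ _ _ _ (fun w p => apex p.2 w / delta)) => w _.
  by apply: continuous_mul => //; exact: continuous_cst.
have cfade : continuous (fun p : R * realization R K => fade p.2).
  exact: clamp_continuous.
have cgather : continuous (fun p : R * realization R K => gather p.2).
  by apply: clamp_continuous; apply: continuous_sub => //; exact: continuous_cst.
have cnorm (z : realization R K -> V -> R) : (forall x, distr (normalize (z x))) ->
    (forall v, continuous (fun p : R * realization R K => z p.2 v)) ->
    forall v, continuous (fun p : R * realization R K => normalize (z p.2) v).
  move=> zD cz v; apply: continuous_div => //;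
    first exact: (continuous_sum (fun u _ => cz u)).
  move=> p; have [_] := zD p.2; apply: contra_eq_neq => E.
  by rewrite big1 ?(eq_sym _ 1) ?oner_neq0 // => u _; rewrite /normalize E invr0 mulr0.
have cfade1 : continuous (fun p : R * realization R K => 1 - fade p.2).
  by apply: continuous_sub => //; exact: continuous_cst.
have cmix v : continuous (fun p : R * realization R K => (1 - fade p.2) * trunc p.2 v).
  exact: continuous_mul.
have c1 v : continuous (fun p : R * realization R K => stage1 p.2 v).
  by apply: cnorm => //; exact: stage1_distr.
have c2 v : continuous (fun p : R * realization R K => stage2 p.2 v).
  apply: (cnorm (fun x v => (1 - fade x) * trunc x v + apex x v));
    first exact: stage2_distr.
  by move=> u; exact: continuous_add.
have c3 v : continuous (fun p : R * realization R K => stage3 p.2 v).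
  apply: (cnorm (fun x v => (1 - fade x) * trunc x v + (1 - gather x) * apex x v
    + gather x * (v == w0)%:R)); first exact: stage3_distr.
  move=> u; apply: continuous_add.
    apply: continuous_add => //; apply: continuous_mul => //.
    by apply: continuous_sub => //; exact: continuous_cst.
  by apply: continuous_mul => //; exact: continuous_cst.
apply: realization_continuous => v.
rewrite (_ : (fun p => _) = fun p => deform p.1 p.2 v); last by apply/funext => -[].
apply: continuous_add.
  apply: continuous_add.
    apply: continuous_add => //; apply: continuous_mul; last exact: continuous_sub.
    by have := cs 0; under eq_fun do rewrite subr0.
  by apply: continuous_mul => //; exact: continuous_sub.
by apply: continuous_mul => //; exact: continuous_sub.
Qed.

End Deformation.

(** * The quotient by the cone faces *)

Lemma continuous_pair (X Y Z : topologicalType) (f : X -> Y) (g : X -> Z) :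
  continuous f -> continuous g -> continuous (fun x => (f x, g x)).
Proof.
move=> cf cg x U [[A C] /= [nA nC] AC].
have nAC : nbhs x (f @^-1` A `&` g @^-1` C)%classic.
  by apply: filterI; [exact: cf|exact: cg].
by apply: (filterS _ nAC) => y [Ay Cy]; exact: (AC (f y, g y)).
Qed.

(** The homotopy inverse of [f] lifts [b] to any preimage and applies [G] at time 0, and [G] itself
    supplies both homotopies. They are continuous on [B] because they become continuous after
    composition with the quotient map [f]. *)
Lemma collapse_homotopy_equivalent (R : realType) (X B : topologicalType)
    (f : X -> B) (G : R * X -> X) :
  compact [set: X] -> hausdorff_space B ->
  continuous f -> (forall b, exists x, f x = b) ->
  continuous G -> (forall x, G (1, x) = x) ->
  (forall t x y, f x = f y -> f (G (t, x)) = f (G (t, y))) ->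
  (forall x y, f x = f y -> G (0, x) = G (0, y)) ->
  homotopy_equivalent R X B.
Proof.
move=> cX hB cf fsurj cG G1 Gf G0.
(* This section need not be continuous; the hypotheses [Gf] and [G0] make the results independent of
   its values. *)
have [s sK] := choice fsurj.
have cG0 : continuous (fun p : R * B => G (0, s p.2)).
  apply: (compact_quotient_continuous (h := fun p : R * B => G (0,
    s p.2)) cX hB cf fsurj).
  rewrite (_ : (fun p => _) = (fun p : R * X => G (0, p.2))); last first.
    by apply/funext => p /=; apply: G0; rewrite sK.
  move=> p; apply: (@continuous_comp _ _ _ (fun p : R * X => (0 : R, p.2)) G);
    last exact: cG.
  by apply: continuous_pair => q; [exact: cvg_cst|exact: cvg_snd].
exists f, (fun b => G (0, s b)); split => //.
- move=> b; apply: (@continuous_comp _ _ _ (fun b : B => (0 : R,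
  b)) (fun p : R * B => G (0, s p.2))); last exact: cG0.
  by apply: continuous_pair => c; [exact: cvg_cst|exact: cvg_id].
- exists G; split => //; first exact: continuous_subspaceT.
  by move=> x /=; apply: G0; rewrite sK.
- exists (fun p => f (G (p.1, s p.2))); split => //=; last by move=> b; rewrite G1 sK.
  apply: continuous_subspaceT.
  apply: (compact_quotient_continuous (h := fun p : R * B => f (G (p.1,
    s p.2))) cX hB cf fsurj).
  rewrite (_ : (fun p => _) = f \o G); last first.
    by apply/funext => -[t x] /=; apply: Gf; rewrite sK.
  by move=> p; apply: continuous_comp; [exact: cG|exact: cf].
Qed.

Section ConeCollapse.
Context {R : realType} {V : finType} {K : simplicial_complex V}.
Variables (W : {set V}) (w0 : V).
Hypothesis w0W : w0 \in W.
Hypothesis flagW : forall A U : {set V}, A \in faces K -> U \subset W ->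
  {in A & U, forall e w, [set e; w] \in faces K} -> A :|: U \in faces K.

Variables (C : finType) (d : C -> nat) (vtx : forall c, 'I_(d c).+1 -> V).
Hypothesis vtx_inj : forall c, injective (@vtx c).
Hypothesis facet_inj : injective (fun c => facet (@vtx c)).
Hypothesis facet_face : forall c, facet (@vtx c) \in faces K.
Hypothesis facet_max : forall c A, A \in faces K -> facet (@vtx c) \subset A ->
  A = facet (@vtx c).
Hypothesis facet_cone : forall c, ~~ @cone V K W (facet (@vtx c)).
Hypothesis cone_or_facet : forall A, A \in faces K -> ~~ @cone V K W A ->
  exists c, A = facet (@vtx c).

Variables (B : ptopologicalType) (inj : forall c, sphere R (d c) -> B).
Hypothesis B_hausdorff : hausdorff_space B.
Hypothesis inj_continuous : forall c, continuous (@inj c).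
Hypothesis inj_point : forall c, @inj c point = point.
Hypothesis inj_inj : forall c c' s s', s != point -> @inj c s = @inj c' s' ->
  existT (fun c => sphere R (d c)) c s = existT _ c' s'.
Hypothesis inj_cover : forall b, b = point \/ exists c s, b = @inj c s.

Let pinch_at c (x : realization R K) : sphere R (d c) :=
  pinch (@vtx_inj c) (@facet_max c) x.

Definition cone_collapse (x : realization R K) : B :=
  if pselect (exists c, supp x = facet (@vtx c)) is left h
  then inj (pinch_at (projT1 (cid h)) x) else point.

Lemma cone_collapse_facet x c : supp x = facet (@vtx c) ->
  cone_collapse x = inj (pinch_at c x).
Proof.
move=> xc; rewrite /cone_collapse; case: pselect => [h|]; last by case; exists c.
by case: (cid h) => c' /= xc'; rewrite (facet_inj (etrans (esym xc') xc)).
Qed.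

Lemma cone_collapse_cone x : cone (K := K) W (supp x) -> cone_collapse x = point.
Proof.
move=> cx; rewrite /cone_collapse; case: pselect => // -[c xc].
by have := facet_cone c; rewrite -xc cx.
Qed.

(** Near a point interior to a critical facet the map agrees with one pinch map. At any other point
    all pinch maps take the pole as value, and finitely many neighbourhoods can be intersected. *)
Lemma cone_collapse_continuous : continuous cone_collapse.
Proof.
have cpinch c : continuous (pinch_at c) by exact: pinch_continuous.
move=> x; have [[c xc]|nx] := pselect (exists c, supp x = facet (@vtx c)).
  have pn : pinch_at c x != point by rewrite pinch_pole xc negbK.
  have near_x : \forall y \near x, inj (pinch_at c y) = cone_collapse y.
    have nx : nbhs x (pinch_at c @^-1` (~` [set point]))%classic.
      apply: cpinch; apply: open_nbhs_nbhs; split; last exact/eqP.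
      apply: closed_openC; apply: accessible_closed_set1.
      exact/hausdorff_accessible/sphere_hausdorff.
    apply: (filterS _ nx) => y /= /eqP; rewrite pinch_pole negbK => /eqP yc.
    by rewrite (cone_collapse_facet yc).
  apply: cvg_trans (near_eq_cvg near_x) _.
  rewrite (cone_collapse_facet xc).
  exact: (@continuous_comp _ _ _ (pinch_at c) (@inj c) x (cpinch c x)
    (@inj_continuous c _)).
have fx : cone_collapse x = point by rewrite /cone_collapse; case: pselect.
rewrite /continuous_at fx => U nU.
have near_c c : nbhs x ((@inj c \o pinch_at c) @^-1` U)%classic.
  apply: (@continuous_comp _ _ _ (pinch_at c) (@inj c) x (cpinch c x)
    (@inj_continuous c _)).
  have /eqP E : pinch_at c x == point.
    by rewrite pinch_pole; apply/eqP => xc; apply: nx; exists c.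
  by rewrite /= E inj_point.
have nU' : nbhs x (fun y => forall c, U (inj (pinch_at c y))).
  exact: (@filter_forall _ C (fun c => (@inj c \o pinch_at c) @^-1` U)%classic (nbhs
    x) _ near_c).
apply: (filterS _ nU') => y Uy; rewrite /= /cone_collapse; case: pselect => // _.
exact: nbhs_singleton.
Qed.

Lemma cone_collapse_surj b : exists x, cone_collapse x = b.
Proof.
have base : exists x, cone_collapse x = point.
  have w0K : in_realization K (fun v => (v == w0)%:R : R).
    split => [v||]; first exact: ler0n.
      by rewrite (bigD1 w0) //= eqxx big1 ?addr0 // => u /negbTE ->.
    rewrite (_ : finset _ = [set w0]) ?faces_vertex //.
    by apply/setP => v; rewrite !inE pnatr_eq0 eqb0 negbK.
  exists (to_realization w0K); apply: cone_collapse_cone.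
  have [] := coneW w0W flagW (A := [set w0]) _; first by rewrite finset.sub1set.
  move=> /exists_inP [w wW wK] _; apply/exists_inP; exists w => //.
  apply: faces_sub wK; apply: finset.setUS; apply/fintype.subsetP => v.
  by rewrite !inE pnatr_eq0 eqb0 negbK.
have [->|[c [s ->]]] := inj_cover b; first exact: base.
have [->|s0] := eqVneq s point; first by rewrite inj_point.
have [x xc xs] := pinch_surj (@vtx_inj c) (facet_face c) (@facet_max c) s0.
by exists x; rewrite (cone_collapse_facet xc) /pinch_at xs.
Qed.

(** The fibres are single points and the cone subcomplex: on an open facet the pinch map is
    injective and misses the pole. Thus [B] has the points of the quotient. *)
Lemma cone_collapse_eq x y : cone_collapse x = cone_collapse y ->
  x = y \/ (cone (K := K) W (supp x) /\ cone (K := K) W (supp y)).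
Proof.
have pn c z : supp z = facet (@vtx c) -> pinch_at c z != point.
  by move=> zc; rewrite pinch_pole zc negbK.
have [cx|ncx] := boolP (cone W (supp x)); have [cy|ncy] := boolP (cone W (supp y)).
- by right.
- have [c yc] := cone_or_facet (supp_face y) ncy.
  rewrite cone_collapse_cone // (cone_collapse_facet yc) -(@inj_point c) => E.
  by have := pn _ _ yc; rewrite (existT_inj2 (inj_inj (pn _ _ yc) (esym E))) eqxx.
- have [c xc] := cone_or_facet (supp_face x) ncx.
  rewrite (cone_collapse_cone cy) (cone_collapse_facet xc) -(@inj_point c) => E.
  by have := pn _ _ xc; rewrite (existT_inj2 (inj_inj (pn _ _ xc) E)) eqxx.
- have [c xc] := cone_or_facet (supp_face x) ncx.
  have [c' yc] := cone_or_facet (supp_face y) ncy.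
  rewrite (cone_collapse_facet xc) (cone_collapse_facet yc) => /(inj_inj (pn _ _ xc)) E.
  have cc' : c = c' by exact: existT_inj1 E.
  move: yc E; rewrite -cc' => yc E; left.
  exact: pinch_inj xc yc (existT_inj2 E).
Qed.

Theorem cone_collapse_homotopy_equivalent : homotopy_equivalent R (realization R K) B.
Proof.
apply: (collapse_homotopy_equivalent (f := cone_collapse)
  (G := deformation w0W flagW)) => //.
- exact: realization_compact.
- exact: cone_collapse_continuous.
- exact: cone_collapse_surj.
- exact: deformation_continuous.
- exact: deformation1.
- move=> t x y /cone_collapse_eq [-> //|[cx cy]].
  by rewrite !cone_collapse_cone //; exact: deformation_cone.
- move=> x y /cone_collapse_eq [-> //|[cx cy]].
  by apply: bary_inj => v; rewrite !deformation0_cone.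
Qed.

End ConeCollapse.

(** * Bouquets of spheres *)

Section Bouquet.
Context {I : choiceType} (X : I -> ptopologicalType).

Let Y (o : option I) : ptopologicalType := if o is Some i then X i else unit.

Definition bouquet_in i (x : X i) : bouquet X :=
  @wedge_lift (option I) Y (fun o => @point (Y o)) (Some i) x.

Lemma bouquet_in_continuous i : continuous (@bouquet_in i).
Proof. exact: (@wedge_lift_continuous (option I) Y (fun o => @point (Y o)) (Some i)).
  Qed.

Lemma bouquet_in_point i : bouquet_in (@point (X i)) = point.
Proof.
rewrite /bouquet_in /point /=.
exact: (@wedge_liftE (option I) Y (fun o => @point (Y o)) None point (Some i) point).
Qed.

Lemma bouquet_in_inj i j (x : X i) (y : X j) : x != point ->
  bouquet_in x = bouquet_in y -> existT (fun i => X i) i x = existT _ j y.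
Proof.
(* Two points of the wedge agree when they are equal before gluing or are both base points; [x0]
   excludes the latter. *)
move=> x0 /eqmodP /predU1P [E|/andP [/eqP /= xp _]]; last by rewrite xp eqxx in x0.
have ij : i = j by have [] := existT_inj1 E.
by case: _ / ij in y E *; rewrite (existT_inj2 E).
Qed.

Lemma bouquet_in_neq_point i (x : X i) : x != point -> bouquet_in x != point.
Proof.
move=> x0; apply/eqP; rewrite -(bouquet_in_point i) => /(bouquet_in_inj x0) E.
by rewrite (existT_inj2 E) eqxx in x0.
Qed.

Lemma bouquet_cover (b : bouquet X) :
  b = point \/ exists i (x : X i), b = bouquet_in x.
Proof.
have : [set: wedge (fun o => @point (Y o))]%classic b by [].
rewrite -wedgeTE => -[[i|] _ [x _ <-]]; first by right; exists i, x.
left; rewrite (_ : x = point); last by case: x.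
exact: wedge_liftE.
Qed.

Lemma bouquet_hausdorff :
  (forall i, hausdorff_space (X i)) -> hausdorff_space (bouquet X).
Proof.
move=> hX; apply: (@wedge_hausdorff (option I) Y) => -[i|]; first exact: hX.
by move=> [] [].
Qed.

End Bouquet.

(** * From a classification of critical faces to a nested bouquet *)

Section NestedBouquet.
Context {R : realType} {V : finType} {K : simplicial_complex V}.
Variables (W : {set V}) (w0 : V).
Hypothesis w0W : w0 \in W.
Hypothesis flagW : forall A U : {set V}, A \in faces K -> U \subset W ->
  {in A & U, forall e w, [set e; w] \in faces K} -> A :|: U \in faces K.

Variables (k : nat) (N D : 'I_k -> nat) (class : {set V} -> 'I_k).

Definition critical_faces := [set A in faces K | ~~ @cone V K W A].

Hypothesis critical_max : {in critical_faces & faces K, forall A B : {set V},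
  A \subset B -> B = A}.
Hypothesis critical_card : {in critical_faces, forall A : {set V},
  #|A| = (D (class A)).+1}.
Hypothesis critical_count : forall l,
  #|[set A in critical_faces | class A == l]| = N l.

Let C : finType := {l : 'I_k & 'I_(N l)}.

(** The cast along [critical_count] turns the count of each class into a labelling of its
    members. *)
Let face_of (c : C) : {set V} :=
  enum_val (cast_ord (esym (critical_count (tag c))) (tagged c)).

Let face_ofP c : face_of c \in critical_faces /\ class (face_of c) = tag c.
Proof.
by have := enum_valP (cast_ord (esym (critical_count (tag c))) (tagged c));
  rewrite inE => /andP [? /eqP].
Qed.

Let face_of_inj : injective face_of.
Proof.
move=> c c' E; have [_ cl] := face_ofP c; have [_ cl'] := face_ofP c'.
have tcc : tag c = tag c' by rewrite -cl -cl' E.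
case: c c' E tcc {cl cl'} => [l j] [l' j'] /= E ll'.
case: _ / ll' in j' E *; congr existT.
by have := enum_val_inj E; exact: cast_ord_inj.
Qed.

Let face_of_surj A : A \in critical_faces -> exists c, A = face_of c.
Proof.
move=> AinC; have AF : A \in [set B in critical_faces | class B == class A] by
  rewrite inE AinC eqxx.
exists (existT _ (class A) (cast_ord (critical_count _) (enum_rank_in AF A))).
by rewrite /face_of /= cast_ordK enum_rankK_in.
Qed.

Let face_of_card c : #|face_of c| = (D (tag c)).+1.
Proof. by have [cC cl] := face_ofP c; rewrite critical_card // cl. Qed.

Let vtx c (i : 'I_(D (tag c)).+1) : V := enum_val (cast_ord (esym (face_of_card c)) i).

Let vtx_inj c : injective (@vtx c).
Proof. by move=> i j /enum_val_inj /cast_ord_inj. Qed.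

Let facet_vtx c : facet (@vtx c) = face_of c.
Proof.
apply/setP => v; apply/imsetP/idP => [[i _ ->]|vc]; first exact: enum_valP.
exists (cast_ord (face_of_card c) (enum_rank_in vc v)) => //.
by rewrite /vtx cast_ordK enum_rankK_in.
Qed.

Theorem critical_faces_bouquet : homotopy_equivalent R (realization R K)
  (bouquet (fun l : 'I_k => bouquet (fun _ : 'I_(N l) => sphere R (D l)))).
Proof.
pose inner l : ptopologicalType := bouquet (fun _ : 'I_(N l) => sphere R (D l)).
pose inj (c : C) (s : sphere R (D (tag c))) : bouquet inner :=
  bouquet_in (bouquet_in (X := fun _ : 'I_(N (tag c)) => sphere R (D (tag c))) (i :=
    tagged c) s).
have critP c : (face_of c \in faces K) /\ ~~ @cone V K W (face_of c).
  by have [] := face_ofP c; rewrite inE => /andP.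
apply: (@cone_collapse_homotopy_equivalent R V K W w0 w0W flagW C
  (fun c => D (tag c)) vtx vtx_inj _ _ _ _ _ (bouquet inner) inj).
- by move=> c c'; rewrite !facet_vtx => /face_of_inj.
- by move=> c; rewrite facet_vtx; case: (critP c).
- by move=> c A AK; rewrite facet_vtx => cA; apply: critical_max => //;
  case: (face_ofP c).
- by move=> c; rewrite facet_vtx; case: (critP c).
- move=> A AK ncA; have [|c ->] := @face_of_surj A; first by rewrite inE AK.
  by exists c; rewrite facet_vtx.
- by apply: bouquet_hausdorff => l; apply: bouquet_hausdorff => _;
  exact: sphere_hausdorff.
- move=> c s; apply: (@continuous_comp _ _ _
    (@bouquet_in _ (fun _ : 'I_(N (tag c)) => sphere R (D (tag c))) (tagged c))
    (@bouquet_in _ inner (tag c))); exact: bouquet_in_continuous.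
- by move=> c; rewrite /inj bouquet_in_point; exact: bouquet_in_point.
- move=> [l j] [l' j'] /= s s' s0 E.
  (* The wedges are peeled off one at a time; the outer one is injective here only because the inner
     image avoids the base point. *)
  have in0 : bouquet_in (X := fun _ : 'I_(N l) => sphere R (D l)) (i := j) s != point.
    exact: bouquet_in_neq_point.
  have E1 := bouquet_in_inj in0 E.
  have ll' : l = l' by exact: existT_inj1 E1.
  case: _ / ll' in j' s' E E1 *; rewrite /= in E1.
  have E2 := @bouquet_in_inj _ (fun _ : 'I_(N l) => sphere R (D l)) j j' s s' s0
    (existT_inj2 E1).
  have jj' : j = j' by exact: existT_inj1 E2.
  by case: _ / jj' in s' E E1 E2 *; rewrite (existT_inj2 E2).
- move=> b; have [->|[l [b' ->]]] := bouquet_cover b; first by left.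
  have [->|[j [s ->]]] := bouquet_cover b'; first by left; rewrite bouquet_in_point.
  by right; exists (existT _ l j), s.
Qed.

End NestedBouquet.

Local Close Scope ring_scope.

(** * Matchings of caterpillars *)

Section Tiling.
Variable n : nat.
Implicit Types (b : {set 'I_n}) (B : {set {set 'I_n}}).

Lemma is_blockP b : reflect (exists p q : 'I_n, q = p.+1 :> nat /\ b = [set p;
  q]) (is_block b).
Proof.
apply: (iffP existsP) => [[p /existsP [q /andP [/eqP pq /eqP ->]]]|[p [q [pq ->]]]].
  by exists p, q.
by exists p; apply/existsP; exists q; rewrite pq !eqxx.
Qed.

Lemma card_block b : is_block b -> #|b| = 2.
Proof.
move=> /is_blockP [p [q [pq ->]]]; rewrite cards2.
by rewrite (_ : p != q) // -val_eqE /= pq neq_ltn ltnSn.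
Qed.

(* The least position where two tilings of a set differ would be covered twice. *)
Lemma tiling_sub B B' : {in B, forall b, is_block b} -> {in B', forall b, is_block b} ->
  finset.trivIset B -> finset.trivIset B' -> finset.cover B = finset.cover B' -> B
    \subset B'.
Proof.
move=> bB bB' tB tB' BB';
  apply/fintype.subsetP => b /[dup] /bB /is_blockP [p [q [pq ->]]].
have [N] := ubnP (p : nat); elim: N => // N IH in B B' bB bB' tB tB' BB' p q pq *.
rewrite ltnS => pN pqB.
have : p \in finset.cover B' by rewrite -BB'; apply/finset.bigcupP; exists [set p;
  q]; rewrite ?set21.
case/finset.bigcupP => b' b'B; have /is_blockP [p' [q' [pq' b'E]]] := bB' _ b'B.
rewrite b'E in b'B *; case/set2P => pp'.
  by rewrite pp' (_ : q = q') //; apply: val_inj; rewrite /= pq pq' pp'.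
(* The block of [B'] that ends at [p] starts one position earlier, so induction with [B] and [B']
   exchanged puts it in [B], where it meets [[set p; q]] at [p]. *)
have p'B : [set p'; q'] \in B.
  by apply: (IH B' B) => //; rewrite -[X in _ < X]subn0; move: pN; rewrite pp' pq'; lia.
have := finset.trivIsetP tB _ _ pqB p'B.
have -> : [set p; q] != [set p'; q'].
  apply/eqP => /setP /(_ p'); rewrite set21 => /set2P [] /(congr1 val) /=;
    rewrite ?pq ?pp' ?pq'; lia.
by move=> /(_ isT) /pred0P /(_ p); rewrite /= set21 pp' set22.
Qed.

Lemma tiling_unique B B' : {in B, forall b, is_block b} -> {in B', forall b,
  is_block b} ->
  finset.trivIset B -> finset.trivIset B' -> finset.cover B = finset.cover B' -> B = B'.
Proof.
by move=> *; apply/eqP; rewrite finset.eqEsubset; apply/andP; split; apply: tiling_sub.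
Qed.

End Tiling.

(** * Critical matchings and their size *)

Section CaterpillarMatchings.
Variables (n : nat) (m : 'I_n -> nat).
Hypothesis m_ge1 : forall i, 1 <= m i.

Local Notation G := (caterpillar m).
Local Notation E := (edge G).
Local Notation K := (matching_complex G).
Implicit Types (e f : E) (i j : 'I_n) (A M : {set E}).

Definition center i : G := inl i.
Definition leaf i (l : 'I_(m i)) : G := inr (existT _ i l).

(** The trace of an edge on the central path is a singleton for a leg and a block for a central
    edge. The matching condition is read off from these traces. *)
Definition ends e : {set 'I_n} := [set i | center i \in val e].

Lemma leg_subproof i (l : 'I_(m i)) : [set center i; leaf l] \in edges G.
Proof. by apply/imsetP; exists (center i, leaf l); rewrite ?inE /=. Qed.

Definition leg i (l : 'I_(m i)) : E :=
  exist (fun e : {set G} => e \in edges G) _ (leg_subproof l).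

Lemma ends_leg i l : ends (@leg i l) = [set i].
Proof. by apply/setP => j; rewrite !inE /= orbF. Qed.

Lemma leg_inj i : injective (@leg i).
Proof.
move=> l l' /(congr1 val) /= /setP /(_ (leaf l)).
rewrite set22 => /esym /set2P [//|] []; exact: existT_inj2.
Qed.

Lemma central_subproof i j : j = i.+1 :> nat -> [set center i; center j] \in edges G.
Proof. by move=> ij; apply/imsetP; exists (center i, center j);
  rewrite ?inE //= ij eqxx. Qed.

Lemma edgeP e : (exists i l, e = @leg i l) \/ is_block (ends e).
Proof.
case: e => e /[dup] /imsetP [[u v]]; rewrite inE /=.
have block (i j : 'I_n) ee : j = i.+1 :> nat -> e = [set center i; center j] ->
    is_block (ends (exist (fun e : {set G} => e \in edges G) e ee)).
  move=> ij eE; apply/is_blockP; exists i, j; split => //.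
  by apply/setP => h; rewrite inE /= eE !inE.
case: u v => [i|[i l]] [j|[j l']] //= uv eE ee.
- have [/eqP ij|/eqP ji] := orP uv; right; first exact: (block i j).
  by apply: (block j i) => //; rewrite eE finset.setUC.
- move: uv => /= /eqP ij; left; case: _ / ij in eE *; exists j, l'; exact: val_inj.
- move: uv => /= /eqP ij; left; case: _ / ij in eE *; exists i, l; apply: val_inj.
  by rewrite /= eE finset.setUC.
Qed.

Lemma ends_neq0 e : exists i, i \in ends e.
Proof.
have [[i [l ->]]|/is_blockP [p [q [_ ->]]]] := edgeP e.
  by exists i; rewrite ends_leg set11.
by exists p; rewrite set21.
Qed.

Lemma leg_not_block i l : is_block (ends (@leg i l)) = false.
Proof. by apply: contraTF isT => /card_block; rewrite ends_leg cards1. Qed.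

Lemma leaf_edge e i (l : 'I_(m i)) : leaf l \in val e -> e = leg l.
Proof.
move=> le; apply: val_inj => /=; case/imsetP: (valP e) le => [[u v]].
rewrite inE /= => uv ->; case/set2P => E; move: uv; rewrite -E.
  by case: v E => [j|//] _ /= /eqP <-; rewrite finset.setUC.
by case: u E => [j|//] _ /= /eqP <-.
Qed.

Lemma ends_block_inj e f : is_block (ends e) -> ends e = ends f -> e = f.
Proof.
have valE g : is_block (ends g) -> val g = [set center i | i in ends g].
  move=> bg; apply/setP => u; apply/idP/imsetP => [ug|[i ig ->]]; last by move: ig;
    rewrite inE.
  case: u ug => [i ig|[i l] ug]; first by exists i; rewrite ?inE.
  by have gl : g = leg l := leaf_edge ug; rewrite gl leg_not_block in bg.
by move=> be ef; apply: val_inj; rewrite !valE -?ef.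
Qed.

(** Distinct edges never share a leaf, since a leaf determines its edge; so they can only meet on
    the central path. *)
Lemma disjoint_ends e f : e != f -> [disjoint val e & val f] = [disjoint ends e &
  ends f].
Proof.
move=> ef; apply/idP/idP => /pred0P d0; apply/pred0P => u /=.
  by have := d0 (center u); rewrite !inE.
apply/negP => /andP [ue uf]; case: u ue uf => [i ie jf|[i l] ie jf].
  by have := d0 i; rewrite /= !inE ie jf.
by rewrite (leaf_edge (ie : leaf l \in val e)) (leaf_edge (jf : leaf l \in val f))
  eqxx in ef.
Qed.

Lemma matchingP M : reflect
  (forall i e f, e \in M -> f \in M -> i \in ends e -> i \in ends f -> e = f)
  (M \in faces K).
Proof.
rewrite inE; apply: (iffP forall_inP) => [mM i e f eM fM ie jf|mM e eM].
  apply/eqP/negPn/negP => ef; have /forall_inP /(_ f fM) := mM e eM.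
  by rewrite ef disjoint_ends //= => /pred0P /(_ i); rewrite /= ie jf.
apply/forall_inP => f fM; apply/implyP => ef; rewrite disjoint_ends //.
by apply/pred0P => i; apply/negP => /andP [ie jf]; rewrite (mM i e f) ?eqxx in ef.
Qed.

Definition first_leg i : E := leg (Ordinal (m_ge1 i)).
Definition first_legs : {set E} := [set first_leg i | i : 'I_n].

Lemma ends_first_leg i : ends (first_leg i) = [set i]. Proof. exact: ends_leg. Qed.

(** A conflict between an edge of [A] and one of [U] already shows on that pair, and two first legs
    at the same central vertex coincide. *)
Lemma first_legs_flag (A U : {set E}) : A \in faces K -> U \subset first_legs ->
  {in A & U, forall e w, [set e; w] \in faces K} -> A :|: U \in faces K.
Proof.
move=> /matchingP mA /fintype.subsetP UW AU; apply/matchingP => i e f.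
have AUe e' w : e' \in A -> w \in U -> i \in ends e' -> i \in ends w -> e' = w.
  by move=> eA wU; apply: (matchingP _ (AU _ _ eA wU)); rewrite ?set21 ?set22.
have first w : w \in U -> i \in ends w -> w = first_leg i.
  by move=> /UW /imsetP [j _ ->]; rewrite ends_first_leg => /set1P ->.
move=> /setUP [eA|eU] /setUP [fA|fU] ie jf.
- exact: (mA i).
- exact: AUe.
- by apply/esym; exact: AUe.
- by rewrite (first e) // (first f).
Qed.

Local Notation critical := (@critical_faces _ K first_legs).

(** If every edge of [A] at [i] is [first_leg i], that leg can be added to [A]. Conversely, a
    different edge of [A] at [i] blocks it. *)
Lemma criticalP A : reflect
  (A \in faces K /\ forall i, exists2 e, e \in A & i \in ends e /\ e != first_leg i)
  (A \in critical).
Proof.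
rewrite [A \in critical]finset.in_set; apply: (iffP idP) => [/andP [AK cA]|[AK cA]].
  split=> //.
  move=> i; apply: contrapT => ne; case/negP: cA; apply/exists_inP.
  exists (first_leg i); first exact: imset_f.
  have eA e : e \in A -> i \in ends e -> e = first_leg i.
    by move=> eA ie; apply/eqP/negPn/negP => ew; apply: ne; exists e.
  apply/matchingP => j e f /setU1P [->|eA'] /setU1P [->|fA] //.
  - by rewrite {1}ends_first_leg => /set1P -> /(eA _ fA).
  - by move=> /[swap]; rewrite {1}ends_first_leg => /set1P -> /(eA _ eA').
  - exact: (matchingP _ AK j).
rewrite AK; apply/negP => /exists_inP [_ /imsetP [i _ ->] wA].
have [e eA [ie /eqP]] := cA i; apply.
by apply: (matchingP _ wA i) => //; rewrite ?setU11 ?ends_first_leg ?set11 // setU1r.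
Qed.

(** A critical matching covers all central vertices and every edge has a central end, so no edge can
    be added. *)
Lemma critical_max : {in critical & faces K, forall A B : {set E},
  A \subset B -> B = A}.
Proof.
move=> A B /criticalP [_ cA] BK /fintype.subsetP AB; apply/setP => e; apply/idP/idP;
  last exact: AB.
have [i ie] := ends_neq0 e; have [f fA [jf _]] := cA i => eB.
by rewrite (matchingP _ BK i e f) // AB.
Qed.

Definition marks A : {set 'I_n} := [set i | [exists l, @leg i l \in A]].

Lemma card_ends e : #|ends e| = 1 + is_block (ends e).
Proof.
have [[i [l ->]]|be] := edgeP e; first by rewrite leg_not_block ends_leg cards1.
by rewrite be card_block.
Qed.

Lemma marksP A i : A \in critical ->
  reflect (exists2 e, e \in A & i \in ends e /\ ~~ is_block (ends e)) (i \in marks A).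
Proof.
move=> _; rewrite inE; apply: (iffP existsP) => [[l lA]|[e eA [ie eb]]].
  by exists (leg l); rewrite ?leg_not_block ?ends_leg ?set11.
have [[j [l eE]]|be] := edgeP e; last by rewrite be in eb.
by move: ie; rewrite eE ends_leg => /set1P ->; exists l; rewrite -eE.
Qed.

Lemma critical_edge A i : A \in critical -> exists2 e, e \in A & i \in ends e.
Proof. by move=> /criticalP [_ /(_ i)] [e eA [ie _]]; exists e. Qed.

(** Double counting of incidences: each central vertex lies on exactly one edge of [A]. A central
    edge contributes 2 to [n] and nothing to the marks, a leg 1 to each, so every edge accounts for
    2. *)
Lemma card_critical A : A \in critical -> #|A| * 2 = n + #|marks A|.
Proof.
move=> Ac; have /criticalP [/matchingP mA _] := Ac.
have one i : \sum_(e in A) (i \in ends e) = 1.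
  have [e eA ie] := critical_edge i Ac.
  rewrite (bigD1 e) //= ie big1 // => f /andP [fA fe].
  by apply/eqP; rewrite eqb0; apply: contraNN fe => jf; apply/eqP; exact: (mA i).
have mk i : (i \in marks A : nat) = \sum_(e in A) (i \in ends e) * ~~ is_block (ends e).
  have [e eA ie] := critical_edge i Ac.
  rewrite (bigD1 e) //= ie big1 ?addn0 ?mul1n => [|f /andP [fA fe]].
    congr nat_of_bool; apply/(marksP _ Ac)/idP => [[f fA [jf]]|eb]; last by exists e.
    by rewrite (mA i e f).
  by rewrite (_ : i \in ends f = false) //; apply: contraNF fe => jf; apply/eqP;
    exact: (mA i).
have card1 e : \sum_i (i \in ends e) = #|ends e|.
  by rewrite -sum1_card [RHS]big_mkcond /=; apply: eq_bigr => i _; case: ifP.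
have nE : n = \sum_(i < n) \sum_(e in A) (i \in ends e).
  by under eq_bigr do rewrite one; rewrite sum_nat_const card_ord muln1.
rewrite [n in n + _]nE -[#|marks A|]sum1_card.
rewrite [X in _ + X]big_mkcond /=.
rewrite [X in _ + X](eq_bigr (fun i => \sum_(e in A) (i \in ends e) * ~~ is_block
  (ends e))); last first.
  by move=> i _; rewrite -mk; case: ifP.
rewrite [X in X + _]exchange_big [X in _ + X]exchange_big /=.
rewrite -big_split /= -sum1_card big_distrl /=.
apply: eq_bigr => e _; rewrite -big_distrl /= card1 card_ends.
by case: is_block.
Qed.

End CaterpillarMatchings.

(** * Counting critical matchings *)

Section CriticalCount.
Variables (n : nat) (m : 'I_n -> nat).
Hypothesis m_ge1 : forall i, 1 <= m i.

Local Notation G := (caterpillar m).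
Local Notation E := (edge G).
Local Notation K := (matching_complex G).
Local Notation critical := (critical_faces (K := K) (first_legs m_ge1)).
Implicit Types (e f : E) (i j : 'I_n) (A : {set E}) (B : {set {set 'I_n}}).

Lemma critical_unique A i e f : A \in critical -> e \in A -> f \in A ->
  i \in ends e -> i \in ends f -> e = f.
Proof. by move=> /criticalP [/matchingP mA _]; exact: mA. Qed.

Lemma card_tiling B (U : {set 'I_n}) : {in B, forall b : {set 'I_n}, is_block b} ->
  finset.trivIset B -> finset.cover B = U -> #|B| * 2 = #|U|.
Proof.
move=> bB /eqP tB <-; rewrite -tB -sum_nat_const.
by apply: eq_bigr => b /bB /card_block.
Qed.

Definition blocks_of A : {set {set 'I_n}} := [set ends e | e in A & is_block (ends e)].

Lemma blocks_ofP A b :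
  reflect (exists e, [/\ e \in A, is_block (ends e) & b = ends e]) (b \in blocks_of A).
Proof.
apply: (iffP imsetP) => [[e]|[e [eA be ->]]]; last by exists e; rewrite ?inE ?eA.
by rewrite inE => /andP [eA be] ->; exists e.
Qed.

Lemma blocks_of_block A : {in blocks_of A, forall b : {set 'I_n}, is_block b}.
Proof. by move=> _ /blocks_ofP [e [_ be ->]]. Qed.

Lemma blocks_of_triv A : A \in critical -> finset.trivIset (blocks_of A).
Proof.
move=> Ac; apply/finset.trivIsetP => _ _ /blocks_ofP [e [eA _ ->]] /blocks_ofP [f [fA
  _ ->]].
apply: contraR => /pred0Pn [i /andP [/= ie jf]].
by rewrite (critical_unique Ac eA fA ie jf).
Qed.

Lemma blocks_of_cover A : A \in critical -> finset.cover (blocks_of A) = ~: marks A.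
Proof.
move=> Ac; apply/setP => i; rewrite finset.in_setC.
apply/finset.bigcupP/idP => [[_ /blocks_ofP [e [eA be ->]] ie]|iA].
  apply/(marksP _ Ac) => -[f fA [jf bf]].
  by rewrite -(critical_unique Ac eA fA ie jf) be in bf.
have [e eA ie] := critical_edge i Ac; exists (ends e) => //; apply/blocks_ofP;
  exists e; split=> //;
apply: contraR iA => be; apply/(marksP _ Ac).
by exists e.
Qed.

Section FixedMarks.
Variables (s : seq 'I_n) (B : {set {set 'I_n}}).
Hypothesis s_uniq : uniq s.
Hypothesis B_block : {in B, forall b : {set 'I_n}, is_block b}.
Hypothesis B_triv : finset.trivIset B.
Hypothesis B_cover : finset.cover B = [set i | i \notin s].

(** With the marks and the tiling fixed, a critical matching amounts to a choice of one edge at each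
    central vertex; as a family of sets these choices are counted by a product. *)
Definition choices i : {set E} :=
  if i \in s then [set @leg n m i l | l : 'I_(m i)] :\ first_leg m_ge1 i
  else [set e | (i \in ends e) && (ends e \in B)].

Lemma card_choices i : #|choices i| = if i \in s then m i - 1 else 1.
Proof.
rewrite /choices; case: ifP => is_.
  have fl : first_leg m_ge1 i \in [set @leg n m i l | l : 'I_(m i)] by exact: imset_f.
  have := cardsD1 (first_leg m_ge1 i) [set @leg n m i l | l : 'I_(m i)].
  rewrite fl card_imset ?card_ord => [mE|]; last exact: leg_inj.
  by rewrite [X in _ = X - 1]mE addKn.
have : i \in finset.cover B by rewrite B_cover inE is_.
move=> /finset.bigcupP [b bB ib]; have /is_blockP [p [q [pq bE]]] := B_block bB.
pose e0 : E := exist (fun e : {set G} => e \in edges G) _ (central_subproof m pq).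
have e0E : ends e0 = b by apply/setP => j; rewrite inE /= bE !inE.
rewrite (_ : [set _ | _] = [set e0]) ?cards1 //; apply/setP => e.
rewrite finset.in_set finset.in_set1.
apply/andP/eqP => [[ie eB]|->]; last by rewrite e0E; split.
apply: ends_block_inj; first exact: B_block.
rewrite e0E; apply: contrapT => /eqP ne;
  have /pred0P /(_ i) := finset.trivIsetP B_triv _ _ eB bB ne.
by rewrite /= ie ib.
Qed.

Lemma choices_ends i e : e \in choices i -> i \in ends e.
Proof.
rewrite /choices; case: ifP => _; last by rewrite inE => /andP [].
by move=> /setD1P [_ /imsetP [l _ ->]]; rewrite ends_leg set11.
Qed.

(** The two ends of a block have the same unique choice, so independent choices at all vertices
    never conflict. *)
Lemma choices_same (phi : {ffun 'I_n -> E}) i j : phi \in family choices ->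
  j \in ends (phi i) -> phi j = phi i.
Proof.
move=> /familyP /= ch; have := ch i; rewrite {1}/choices; case: ifP => is_.
  by move=> /setD1P [_ /imsetP [l _ E]]; rewrite {1}E ends_leg => /set1P ->.
rewrite inE => /andP [ii iB] ij.
have js : j \notin s.
  have : j \in finset.cover B by apply/finset.bigcupP; exists (ends (phi i)).
  by rewrite B_cover inE.
have := ch j; rewrite {1}/choices (negbTE js) inE => /andP [jj jB].
apply: ends_block_inj; first exact: B_block.
apply: contrapT => /eqP ne; have /pred0P /(_ j) := finset.trivIsetP B_triv _ _ jB iB ne.
by rewrite /= jj ij.
Qed.

Definition chosen (phi : {ffun 'I_n -> E}) : {set E} := [set phi i | i : 'I_n].

Lemma chosen_at phi i e : phi \in family choices -> e \in chosen phi ->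
  i \in ends e -> e = phi i.
Proof. by move=> ch /imsetP [j _ ->] ij; rewrite (choices_same ch ij). Qed.

Lemma chosen_critical phi : phi \in family choices -> chosen phi \in critical.
Proof.
move=> ch; apply/criticalP; split=> [|i].
  apply/matchingP => i e f eA fA ie jf.
  by rewrite (chosen_at ch eA ie) (chosen_at ch fA jf).
have chi := (elimT familyP ch i); exists (phi i); first exact: imset_f.
split; first exact: choices_ends.
move: chi; rewrite /= /choices; case: ifP => _; first by move=> /setD1P [].
rewrite inE => /andP [_ /B_block]; apply: contraTneq => ->.
by rewrite leg_not_block.
Qed.

Lemma chosen_marks phi : phi \in family choices -> marks (chosen phi) = [set i in s].
Proof.
move=> ch; have cc := chosen_critical ch; apply/setP => i; rewrite [RHS]inE.
have chi := (elimT familyP ch i); move: (chi) => /=; rewrite {1}/choices;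
  case: ifP => is_.
  move=> /setD1P [_ /imsetP [l _ E]]; apply/(marksP _ cc).
  by exists (phi i); [exact: imset_f|rewrite E ends_leg set11 -(ends_leg l)
    leg_not_block].
rewrite inE => /andP [_ /B_block bi]; apply/(marksP _ cc) => -[e eA [ie be]].
by rewrite (chosen_at ch eA ie) bi in be.
Qed.

Lemma chosen_inj : {in family choices &, injective chosen}.
Proof.
move=> phi psi ch ch' E; apply/ffunP => i.
apply: (chosen_at ch'); first by rewrite -E imset_f.
exact: choices_ends (elimT familyP ch i).
Qed.

(** The choice at [i] is the edge of [A] covering [i]. *)
Lemma chosen_surj A : A \in critical -> marks A = [set i in s] ->
  A \in [set chosen phi | phi in family choices].
Proof.
move=> Ac As.
have ex i : {e | e \in A & i \in ends e}.
  by apply: cid2; have [e eA ie] := critical_edge i Ac; exists e.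
pose phi : {ffun 'I_n -> E} := [ffun i => s2val (ex i)].
have phiA i : phi i \in A by rewrite ffunE; case: (ex i).
have phi_ends i : i \in ends (phi i) by rewrite ffunE; case: (ex i).
(* The central edges of [A] tile the unmarked positions, and such a tiling is unique. *)
have BA : blocks_of A = B.
  apply: tiling_unique => //; first exact: blocks_of_block.
    exact: blocks_of_triv.
  by rewrite blocks_of_cover // As B_cover; apply/setP => i; rewrite !inE.
have ch : phi \in family choices.
  apply/familyP => i; rewrite /= /choices; case: ifP => is_.
    have : i \in marks A by rewrite As inE.
    rewrite inE => /existsP [l lA].
    have -> : phi i = leg l by apply: (critical_unique Ac _ _ (phi_ends i));
      rewrite ?ends_leg ?set11.
    rewrite finset.in_setD1 imset_f // andbT.
    have /criticalP [_ /(_ i) [e eA [ie]]] := Ac; apply: contraNneq => <-.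
    by apply/eqP; apply: (critical_unique Ac _ _ ie); rewrite ?ends_leg ?set11.
  rewrite inE phi_ends /= -BA; apply/blocks_ofP; exists (phi i); split=> //.
  apply: contraFT is_ => nb; have : i \in marks A by apply/(marksP _ Ac);
    exists (phi i).
  by rewrite As inE.
apply/imsetP; exists phi => //; apply/setP => e; apply/idP/imsetP => [eA|[i _ ->]] //.
have [i ie] := ends_neq0 e; exists i => //.
exact: (critical_unique Ac eA (phiA i) ie).
Qed.

(** The map [chosen] is a bijection from choice functions; unmarked vertices contribute factors 1,
    which drop out of the product. *)
Lemma card_fixed_marks :
  #|[set A in critical | marks A == [set i in s]]| = \prod_(i <- s) (m i - 1).
Proof.
have -> : [set A in critical | marks A == [set i in s]] = [set chosen phi | phi in
  family choices].
  apply/setP => A; rewrite finset.in_set; apply/andP/idP => [[Ac /eqP]|];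
    first exact: chosen_surj.
  move=> /imsetP [phi ch ->]; split; first exact: chosen_critical.
  by rewrite chosen_marks.
rewrite card_in_imset ?card_family; last exact: chosen_inj.
rewrite foldrE big_map big_enum /= (eq_bigr _ (fun i _ => card_choices i)).
by rewrite -big_mkcond /= big_uniq.
Qed.

End FixedMarks.

(** The blocks cover [n - x] positions, as many as are unmarked, so the inclusion in the definition
    is an equality. *)
Lemma marked_sequencesP x (s : x.-tuple 'I_n) : s \in marked_sequences n x -> uniq s /\
  exists B, [/\ {in B, forall b : {set 'I_n}, is_block b}, finset.trivIset B
    & finset.cover B = [set i | i \notin s]].
Proof.
rewrite inE => /andP [ss /existsP [B /and4P [/forall_inP bB tB /eqP cB sB]]].
have us : uniq s by rewrite -(map_inj_uniq val_inj);
  exact: sorted_uniq ltn_trans ltnn _ ss.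
split=> //; exists B; split=> //; apply/esym/eqP; rewrite eqEcard sB /=.
rewrite -(card_tiling bB tB erefl) muln2 cB.
have -> : [set i | i \notin s] = ~: [set i in s] by apply/setP => i; rewrite !inE.
by rewrite cardsCs finset.setCK card_ord cardsE (card_uniqP us) size_tuple.
Qed.

Lemma sorted_enum_set (S : {set 'I_n}) : sorted ltn (map val (enum S)).
Proof.
rewrite sorted_map /enum_mem; apply: (sorted_filter (leT := relpre val ltn)).
  by move=> j i k /=; exact: ltn_trans.
by rewrite -sorted_map -enumT val_enum_ord; exact: iota_ltn_sorted.
Qed.

(** A set of positions has exactly one increasing enumeration, and the central edges of [A] provide
    the tiling required of it. *)
Lemma count_sequences A x : A \in critical ->
  #|[set s in marked_sequences n x | marks A == [set i in s]]| = (#|marks A| == x).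
Proof.
move=> Ac; case: eqP => [<-|nx]; last first.
  apply: eq_card0 => s; rewrite finset.in_set.
  apply: contra_notF nx => /andP [/marked_sequencesP [us _] /eqP ->].
  by rewrite cardsE (card_uniqP us) size_tuple.
have es : size (enum (marks A)) == #|marks A| by rewrite -cardE.
apply/eqP/cards1P; exists (Tuple es); apply/setP => s;
  rewrite finset.in_set finset.in_set1.
apply/andP/eqP => [[sM /eqP sA]|->].
  have memS i : (i \in marks A) = (i \in val s).
    by have /setP /(_ i) -> := sA; rewrite finset.in_set.
  apply: val_inj => /=; apply: (inj_map val_inj).
  apply: (irr_sorted_eq ltn_trans ltnn); last 1 first.
  - by move=> i; apply/mapP/mapP => -[j js ->]; exists j => //;
      move: js; rewrite mem_enum memS.
  - by move: sM; rewrite inE => /andP [].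
  - exact: sorted_enum_set.
split; last by apply/eqP/setP => i; rewrite !inE mem_enum inE.
rewrite inE sorted_enum_set; apply/existsP; exists (blocks_of A).
have ct := card_tiling (@blocks_of_block A) (blocks_of_triv Ac) (blocks_of_cover Ac).
apply/and4P; split.
- by apply/forall_inP; exact: blocks_of_block.
- exact: blocks_of_triv.
- by rewrite -muln2 ct cardsCs finset.setCK card_ord.
- rewrite blocks_of_cover //; apply/fintype.subsetP => i.
  by rewrite !inE mem_enum inE.
Qed.

Lemma sum_bool_card (T : finType) (D : {set T}) (P : pred T) :
  \sum_(x in D) (P x : nat) = #|[set x in D | P x]|.
Proof.
rewrite -sum1_card [RHS](eq_bigl (fun x => (x \in D) && P x)).
  by rewrite [RHS]big_mkcondr /=; apply: eq_bigr => x _; case: (P x).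
by move=> x; rewrite finset.in_set.
Qed.

(** Pairs of a critical matching and the increasing sequence of its marks are counted in two
    ways. *)
Lemma critical_count x :
  #|[set A in critical | #|marks A| == x]| = marked_sum x (fun i => m i - 1).
Proof.
rewrite -sum_bool_card (eq_bigr (fun A : {set E} =>
    \sum_(s in marked_sequences n x) (marks A == [set i in s] : nat))); last first.
  by move=> A Ac; rewrite -(count_sequences x Ac) sum_bool_card.
rewrite exchange_big /=; apply: eq_bigr => s /marked_sequencesP [us [B [bB tB cB]]].
by rewrite sum_bool_card (card_fixed_marks us bB tB cB).
Qed.

Lemma mem_first_leg i : first_leg m_ge1 i \in first_legs m_ge1.
Proof. exact: imset_f. Qed.

End CriticalCount.

(** * The homotopy type of the matching complex *)

Theorem theorem5p11 (R : realType) (n : nat) (m : 'I_n -> nat)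
    (n_ge1 : 1 <= n) (m_ge1 : forall i, 1 <= m i) :
  let t := fun i => m i - 1 in
  let MG := realization R (matching_complex (caterpillar m)) in
  (forall k, n = 2 * k ->
    homotopy_equivalent R MG
      (bouquet (fun l : 'I_k.+1 =>
         bouquet (fun _ : 'I_(marked_sum (2 * l) t) =>
           sphere R (k - 1 + l))))) /\
  (forall k, n = 2 * k + 1 ->
    homotopy_equivalent R MG
      (bouquet (fun l : 'I_k.+1 =>
         bouquet (fun _ : 'I_(marked_sum (2 * l + 1) t) =>
           sphere R (k + l))))).
Proof.
move=> t MG; pose W := first_legs m_ge1.
have w0W := mem_first_leg m_ge1 (Ordinal n_ge1).
have marks_le (A : {set edge (caterpillar m)}) : #|marks A| <= n.
  by have := max_card (marks A); rewrite card_ord.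
(* Both parities at once: class [l] consists of the critical matchings with [x l] marks, which have
   dimension [D l]. *)
have main k (x D : 'I_k.+1 -> nat) : injective x ->
    (forall A, A \in critical_faces (K := matching_complex (caterpillar m)) W ->
      exists2 l, #|marks A| = x l & #|A| = (D l).+1) ->
    homotopy_equivalent R MG (bouquet (fun l : 'I_k.+1 =>
      bouquet (fun _ : 'I_(marked_sum (x l) t) => sphere R (D l)))).
  move=> x_inj xD.
  (* The default [ord0] is never reached on critical faces. *)
  pose class (A : {set edge (caterpillar m)}) : 'I_k.+1 := odflt ord0 [pick l |
    #|marks A| == x l].
  have classP A : A \in critical_faces (K := matching_complex (caterpillar m)) W ->
      #|marks A| = x (class A) /\ #|A| = (D (class A)).+1.
    move=> /xD [l ml Al]; rewrite /class; case: pickP => [l' /eqP ml'|/(_ l)].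
      by have -> /= : l' = l by apply: x_inj; rewrite -ml -ml'.
    by rewrite ml eqxx.
  apply: (critical_faces_bouquet w0W (@first_legs_flag n m m_ge1) (class := class)).
  - exact: critical_max.
  - by move=> A /classP [].
  - move=> l; rewrite -critical_count; apply: eq_card => A.
    rewrite [LHS]finset.in_set [RHS]finset.in_set; apply: andb_id2l => Ac.
    by have [-> _] := classP A Ac; rewrite (inj_eq x_inj).
split=> k nk.
- apply: (main k (fun l => 2 * l) (fun l => k - 1 + l)) => [l l' /eqP|A Ac].
    by rewrite eqn_pmul2l // => /eqP /val_inj.
  have cA := card_critical Ac; have lA := marks_le A.
  have lk : #|marks A| %/ 2 < k.+1 by lia.
  (* By [cA] the number of marks has the parity of [n]. The truncated [k - 1] is a true predecessor
     because [n_ge1] gives a positive [k]. *)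
  have [mE AE] : #|marks A| = 2 * (#|marks A| %/ 2) /\ #|A| = (k - 1 + #|marks A| %/
    2).+1 by lia.
  by exists (Ordinal lk).
- apply: (main k (fun l => 2 * l + 1) (fun l => k + l)) => [l l' /eqP|A Ac].
    by rewrite eqn_add2r eqn_pmul2l // => /eqP /val_inj.
  have cA := card_critical Ac; have lA := marks_le A.
  have lk : #|marks A| %/ 2 < k.+1 by lia.
  have [mE AE] : #|marks A| = 2 * (#|marks A| %/ 2) + 1 /\ #|A| = (k + #|marks A| %/
    2).+1 by lia.
  by exists (Ordinal lk).
Qed.
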